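(* Let $(\mathfrak{g},\eta)$ be a contact Lie algebra with Reeb vector $\xi$. Suppose that $\mathfrak{g}$ is unimodular or, more generally, that $(\mathfrak{g},\eta)$ is transversely unimodular. If $\mathfrak{g}$ is isomorphic neither to $\mathfrak{sl}(2,\mathbb{R})$ nor to $\mathfrak{su}(2)$, then the map $\operatorname{ad}_\xi:\mathfrak{g}\to\mathfrak{g}$ is nilpotent.
   Context: All Lie algebras are real and finite-dimensional. A contact Lie algebra is a pair $(\mathfrak{g},\eta)$ with $\dim\mathfrak{g}=2n+1$ and $\eta\in\mathfrak{g}^*$ such that $\eta\wedge(d\eta)^n\neq 0$, where $d\eta(x,y)=-\eta([x,y])$. Its Reeb vector is the unique $\xi\in\mathfrak{g}$ with $\eta(\xi)=1$ and $d\eta(\xi,\cdot)=0$. A Lie algebra $\mathfrak{g}$ is unimodular if $\operatorname{tr}(\operatorname{ad}_x)=0$ for all $x\in\mathfrak{g}$. Let $\mathfrak{h}:=\ker\eta$, which is $\operatorname{ad}_\xi$-invariant, and let $\mathrm{pr}_{\mathfrak{h}}:\mathfrak{g}\to\mathfrak{h}$ be the linear projection associated with the vector space splitting $\mathfrak{g}=\mathbb{R}\xi\oplus\mathfrak{h}$. For $x\in\mathfrak{h}$ put $M_x:=\mathrm{pr}_{\mathfrak{h}}\circ\operatorname{ad}_x|_{\mathfrak{h}}\in\operatorname{End}(\mathfrak{h})$. $(\mathfrak{g},\eta)$ is transversely unimodular if $\operatorname{tr}(M_x)=0$ for all $x\in\ker(\operatorname{ad}_\xi|_{\mathfrak{h}})$.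 Unimodularity implies transverse unimodularity. *)

(* Defs.v *)
From HB Require Import structures.
From mathcomp Require Import all_boot all_order all_fingroup all_algebra.
From mathcomp Require Import complex.
From mathcomp Require Import reals.

Set Implicit Arguments.
Unset Strict Implicit.
Unset Printing Implicit Defensive.

Import GRing.Theory Num.Theory.
Local Open Scope ring_scope.

HB.mixin Record Lmodule_isLieAlgebra (R : pzRingType) V
    of GRing.Lmodule R V := {
  lie : V -> V -> V;
  lie_linear_l : forall y, linear (lie^~ y);
  lie_linear_r : forall x, linear (lie x);
  liexx : forall x, lie x x = 0;
  lie_jacobi : forall x y z,
    lie x (lie y z) + lie y (lie z x) + lie z (lie x y) = 0
}.

#[short(type="lieAlgType")]
HB.structure Definition LieAlgebra (R : pzRingType) :=
  {V of Lmodule_isLieAlgebra R V & GRing.Lmodule R V}.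

#[short(type="finLieAlgType")]
HB.structure Definition FinLieAlgebra (R : nzRingType) :=
  {V of LieAlgebra R V & Vector R V}.

Definition lie_isomorphic (R : pzRingType) (g h : lieAlgType R) : Prop :=
  exists f : {linear g -> h},
    bijective f /\ forall x y, f (lie x y) = lie (f x) (f y).

Definition commmx (S : pzRingType) n (A B : 'M[S]_n) : 'M[S]_n :=
  A *m B - B *m A.

Section Commutator.
Variables (S : comNzRingType) (n : nat).
Implicit Types A B C : 'M[S]_n.

Lemma commmx_linear_l B : linear ((@commmx S n)^~ B).
Proof.
move=> a A C; rewrite /commmx mulmxDr mulmxDl -scalemxAr -scalemxAl.
by rewrite scalerBr opprD addrACA.
Qed.

Lemma commmx_linear_r A : linear (@commmx S n A).
Proof.
move=> a B C; rewrite /commmx mulmxDr mulmxDl -scalemxAr -scalemxAl.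
by rewrite scalerBr opprD addrACA.
Qed.

Lemma commmxx A : commmx A A = 0. Proof. exact: subrr. Qed.

Lemma commmx_jacobi A B C :
  commmx A (commmx B C) + commmx B (commmx C A) + commmx C (commmx A B) = 0.
Proof.
rewrite /commmx !(mulmxBl, mulmxBr) !mulmxA !opprB.
set p := A *m B *m C; set q := A *m C *m B; set r := B *m A *m C.
set s := B *m C *m A; set t := C *m A *m B; set u := C *m B *m A.
have E (a b d e : 'M[S]_n) : a - b + (d - e) = (a + d) - (b + e).
  by rewrite opprD addrACA.
rewrite !E; apply/eqP; rewrite subr_eq0; apply/eqP.
by rewrite !addrA [LHS](ACl (4*3*6*5*2*1)).
Qed.

Lemma mxtrace_commmx A B : \tr (commmx A B) = 0.
Proof. by rewrite linearB /= mxtrace_mulC subrr. Qed.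

End Commutator.

Definition sl2_pred {R : realType} : pred 'M[R]_2 := fun A => \tr A == 0.
Definition sl2 (R : realType) := {A : 'M[R]_2 | sl2_pred A}.

Section SL2.
Variable R : realType.

Fact sl2_submod : subsemimod_closed (@sl2_pred R).
Proof.
split; [split|] => [|A B|a A]; rewrite !unfold_in.
- by rewrite linear0.
- by move=> /eqP tA /eqP tB; rewrite linearD /= tA tB addr0.
- by move=> /eqP tA; rewrite linearZ /= tA mulr0.
Qed.

HB.instance Definition _ := SubChoice.on (sl2 R).
HB.instance Definition _ :=
  GRing.SubChoice_isSubLmodule.Build R 'M[R]_2 (@sl2_pred R) (sl2 R)
    sl2_submod.

Fact sl2_lie_subproof (A B : sl2 R) : sl2_pred (commmx (val A) (val B)).
Proof. by rewrite /sl2_pred mxtrace_commmx. Qed.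

Definition sl2_lie (A B : sl2 R) : sl2 R := Sub _ (sl2_lie_subproof A B).

Fact sl2_lie_linear_l B : linear (sl2_lie^~ B).
Proof.
move=> a A C; apply: val_inj; exact: commmx_linear_l.
Qed.

Fact sl2_lie_linear_r A : linear (sl2_lie A).
Proof.
move=> a B C; apply: val_inj; exact: commmx_linear_r.
Qed.

Fact sl2_liexx A : sl2_lie A A = 0.
Proof. apply: val_inj; exact: commmxx. Qed.

Fact sl2_lie_jacobi A B C :
  sl2_lie A (sl2_lie B C) + sl2_lie B (sl2_lie C A) + sl2_lie C (sl2_lie A B)
  = 0.
Proof. apply: val_inj; exact: commmx_jacobi. Qed.

HB.instance Definition _ := Lmodule_isLieAlgebra.Build R (sl2 R)
  sl2_lie_linear_l sl2_lie_linear_r sl2_liexx sl2_lie_jacobi.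

End SL2.

(* 'M[R[i]]_2 carries its complex scaling; the alias carries the real one. *)
Definition realified_mx (R : realType) := 'M[R[i]]_2.

Section RealifiedMatrices.
Variable R : realType.
Implicit Types (a b : R) (A B : realified_mx R).

Definition realified_scale a A : realified_mx R :=
  (real_complex R a) *: (A : 'M[R[i]]_2).

HB.instance Definition _ := GRing.Zmodule.on (realified_mx R).

Fact realified_scaleA a b A :
  realified_scale a (realified_scale b A) = realified_scale (a * b) A.
Proof. by rewrite /realified_scale scalerA rmorphM. Qed.

Fact realified_scale1 : left_id 1 realified_scale.
Proof. by move=> A; rewrite /realified_scale rmorph1 scale1r. Qed.

Fact realified_scaleDr : right_distributive realified_scale +%R.
Proof. by move=> a A B; apply: scalerDr. Qed.

Fact realified_scaleDl A : {morph realified_scale^~ A : a b / a + b}.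
Proof. by move=> a b; rewrite /realified_scale rmorphD scalerDl. Qed.

HB.instance Definition _ := GRing.Zmodule_isLmodule.Build R (realified_mx R)
  realified_scaleA realified_scale1 realified_scaleDr realified_scaleDl.

End RealifiedMatrices.

Definition adjmx (R : realType) (A : 'M[R[i]]_2) : 'M[R[i]]_2 :=
  map_mx (@conjc R) A^T.

Definition su2_pred {R : realType} : pred (realified_mx R) :=
  fun A => (adjmx A == - A) && (\tr A == 0).
Definition su2 (R : realType) := {A : realified_mx R | su2_pred A}.

Section SU2.
Variable R : realType.

Fact adjmxD (A B : 'M[R[i]]_2) : adjmx (A + B) = adjmx A + adjmx B.
Proof. by rewrite /adjmx linearD map_mxD. Qed.

Fact adjmxZ (a : R) (A : 'M[R[i]]_2) :
  adjmx (real_complex R a *: A) = real_complex R a *: adjmx A.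
Proof. by rewrite /adjmx linearZ map_mxZ /= -/(adjmx A) oppr0. Qed.

Fact adjmxM (A B : 'M[R[i]]_2) : adjmx (A *m B) = adjmx B *m adjmx A.
Proof. by rewrite /adjmx trmx_mul map_mxM. Qed.

Fact su2_submod : subsemimod_closed (@su2_pred R).
Proof.
split; [split|] => [|A B|a A]; rewrite !unfold_in.
- by rewrite /adjmx trmx0 map_mx0 oppr0 linear0 !eqxx.
- move=> /andP[/eqP hA /eqP tA] /andP[/eqP hB /eqP tB].
  by rewrite adjmxD hA hB opprD linearD /= tA tB addr0 !eqxx.
- move=> /andP[/eqP hA /eqP tA].
  rewrite /su2_pred [adjmx _]adjmxZ hA scalerN eqxx /=.
  by rewrite [X in X == _]mxtraceZ tA mulr0.
Qed.

HB.instance Definition _ := SubChoice.on (su2 R).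
HB.instance Definition _ :=
  GRing.SubChoice_isSubLmodule.Build R (realified_mx R) (@su2_pred R) (su2 R)
    su2_submod.

Fact su2_lie_subproof (A B : su2 R) :
  su2_pred (commmx (val A : 'M[R[i]]_2) (val B)).
Proof.
case: A B => [A /= /andP[/eqP hA _]] [B /= /andP[/eqP hB _]].
rewrite /su2_pred mxtrace_commmx eqxx andbT /commmx /adjmx linearB map_mxB.
by rewrite -!/(adjmx _) !adjmxM hA hB !mulNmx !mulmxN !opprK opprB.
Qed.

Definition su2_lie (A B : su2 R) : su2 R := Sub _ (su2_lie_subproof A B).

Fact su2_lie_linear_l B : linear (su2_lie^~ B).
Proof.
move=> a A C; apply: val_inj; exact: commmx_linear_l.
Qed.

Fact su2_lie_linear_r A : linear (su2_lie A).
Proof.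
move=> a B C; apply: val_inj; exact: commmx_linear_r.
Qed.

Fact su2_liexx A : su2_lie A A = 0.
Proof. apply: val_inj; exact: commmxx. Qed.

Fact su2_lie_jacobi A B C :
  su2_lie A (su2_lie B C) + su2_lie B (su2_lie C A) + su2_lie C (su2_lie A B)
  = 0.
Proof.
apply: val_inj; exact: commmx_jacobi.
Qed.

HB.instance Definition _ := Lmodule_isLieAlgebra.Build R (su2 R)
  su2_lie_linear_l su2_lie_linear_r su2_liexx su2_lie_jacobi.

End SU2.

Section Forms.
Variables (F : fieldType) (V : Type).

Definition form (k : nat) := ('I_k -> V) -> F.

(* Exterior product of the alternating forms a and b: each (k, l)-shuffle is
   counted k! l! times in the sum. Alternation and multilinearity are not part
   of the type [form]. *)
Definition wedge k l (a : form k) (b : form l) : form (k + l) := fun v =>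
  (k`! * l`!)%:R^-1 *
  \sum_(s : 'S_(k + l)) (-1) ^+ s * a (fun i => v (s (lshift l i))) *
                                    b (fun j => v (s (rshift k j))).

Fixpoint wedge_exp k (a : form k) (n : nat) : form (n * k) :=
  match n return form (n * k) with
  | 0 => fun=> 1
  | n'.+1 => wedge a (@wedge_exp k a n')
  end.

End Forms.

Arguments wedge_exp {F V k} a n v.

Section ContactLieAlgebras.
Variable R : realType.

Definition lfun_trace (V : vectType R) (f : 'End(V)) : R :=
  \tr (passmx.mxof (vbasis {:V}) (vbasis {:V}) f).

Definition lfun_nilpotent (V : vectType R) (f : 'End(V)) : Prop :=
  exists k, forall x, iter k f x = 0.

Variable g : finLieAlgType R.
Implicit Types (eta : 'Hom(g, R^o)) (xi x y : g).

Definition ad x : 'End(g) := linfun (lie x).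

Lemma adE x y : ad x y = lie x y.
Proof.
pose m := GRing.isLinear.Build R g g *:%R (lie x) (lie_linear_r x).
pose f : {linear g -> g} := HB.pack (lie x) m.
exact: (lfunE f).
Qed.

Definition form_of_dual eta : form R g 1 := fun v => eta (v ord0).

Definition dd eta x y : R := - eta (lie x y).

Definition dform eta : form R g 2 := fun v => dd eta (v ord0) (v ord_max).

Definition contact eta : Prop :=
  exists n, \dim {:g} = n.*2.+1 /\
    exists v, wedge (form_of_dual eta) (wedge_exp (dform eta) n) v != 0.

Definition reeb eta xi : Prop := eta xi = 1 /\ forall y, dd eta xi y = 0.

Definition unimodular : Prop := forall x, lfun_trace (ad x) = 0.

(* Projection of g onto lker eta along <[xi]>, with values in the vector space
   underlying lker eta. *)
Definition pr_ker eta xi : 'Hom(g, subvs_of (lker eta)) :=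
  (linfun (vsproj (lker eta)) \o daddv_pi (lker eta) <[xi]>)%VF.

Definition transverse_ad eta xi x : 'End(subvs_of (lker eta)) :=
  (pr_ker eta xi \o ad x \o linfun (@vsval _ _ (lker eta)))%VF.

Definition transversely_unimodular eta xi : Prop :=
  forall x, x \in (lker (ad xi) :&: lker eta)%VS ->
    lfun_trace (transverse_ad eta xi x) = 0.

End ContactLieAlgebras.

Arguments unimodular {R} g.

(* Main.v *)
From HB Require Import structures.
From mathcomp Require Import all_boot all_order all_fingroup all_algebra.
From mathcomp Require Import spectral complex boolp reals.
From mathcomp Require Import ring zify.
Require Import Defs.

Set Implicit Arguments.
Unset Strict Implicit.
Unset Printing Implicit Defensive.

Import Order.TTheory GRing.Theory Num.Theory passmx.
Local Open Scope ring_scope.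

(** Write D for ad xi and omega for d eta on ker eta.  The operator D
    preserves ker eta and omega, and omega is nondegenerate there.  Assume
    that D is not nilpotent; then g is sl(2) or su(2), for three reasons.

    The centralizer of xi is the line through xi ([centralizer_reeb]).  Some
    c = tr (D^(k+1)) is nonzero, and phi(x) = tr (D^k ad x) / c is a linear
    form with phi(xi) = 1 which kills [z, g] for every z commuting with xi,
    because then ad z commutes with D.  Nondegeneracy of omega yields w in
    ker eta with eta [w, -] = eta - phi; this w commutes with xi, so that
    tr (ad w) = 0 by (transverse) unimodularity, and phi [w, -] = 0.  Hence the
    coadjoint flow of w moves eta along the half-line phi + s (eta - phi),
    s > 0, and preserves the volume form eta /\ (d eta)^n.  In the limit s = 0
    the form phi is contact as well.  Now xi and every z in ker eta commuting
    with xi lie in the kernel of d phi, which is a line: so z = 0.  The proof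
    replaces the flow by an endomorphism T comparing d (eta - phi) with
    d eta: the traces of all its powers are equal, the first one is 0, so T
    is nilpotent; but T fixes z.

    The dimension is 3 ([reeb_spectrum_dim], [contact_dim3]).  As the
    centralizer of xi is a line, g is the sum of this line and of the image
    of D, and therefore tr (q(D) ad x) = tr (q(D) D) eta(x) for every
    polynomial q.  After complexification, choose an eigenvector v of D for
    -la and u with eta [u, v] = 1.  The functional
    tau(q) = tr (q(D) ad u ad v) then satisfies
    tau(q) - tau(q(X - la)) = tr (q(D) D), since ad v shifts the spectrum of D
    by la.  Spelled out on the spectral projectors this is a recurrence for
    the multiplicities of the eigenvalues along each string nu + Z la
    ([eigen_string]), a substitute for root strings.  It forces every
    nonzero eigenvalue to be simple with a double that is no eigenvalue
    ([spectrum_simple]), and, applied to an eigenvalue la of maximal modulus,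
    leaves only 0, la and -la.

    A contact algebra of dimension 3 with this centralizer has a basis xi, x,
    y with [xi, x] = y, [xi, y] = kap x and [x, y] = bet xi, where kap and bet
    are nonzero; the signs of kap and bet decide between sl(2) and su(2)
    ([standard_triple_sl2_su2]). *)

(** * Traces and nilpotency *)

(** A full-rank factorization P = C R of an idempotent satisfies R C = 1, so
    that both traces are the inner dimension. *)
Lemma mxtrace_idempotent (F : fieldType) n (P : 'M[F]_n) :
  P *m P = P -> \tr P = (\rank P)%:R.
Proof.
move=> PP; have CR := mulmx_base P.
suff RC : row_base P *m col_base P = 1%:M.
  by rewrite -[P in \tr P]CR mxtrace_mulC RC mxtrace1.
apply: (row_free_inj (row_base_free P)); rewrite [LHS]/= [RHS]mul1mx.
apply: (row_full_inj (col_base_full P)).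
rewrite -!/(row_base P) -/(col_base P) -[(_ *m _) *m row_base P]mulmxA CR.
by rewrite mulmxA CR PP.
Qed.

(** Write the characteristic polynomial as p X^a with p(0) <> 0.  A Bezout
    relation between p and X^(a+1) provides an idempotent E, multiple of A,
    which projects onto the subspace where A is invertible.  The trace of E is
    its rank, but also a combination of the traces of the positive powers of
    A: hence E = 0 and A^a = 0. *)
Lemma nilpotent_of_mxtrace (F : numFieldType) n (A : 'M[F]_n) :
  (forall k, \tr (A ^+ k.+1) = 0) -> exists k, A ^+ k = 0.
Proof.
case: n A => [|n] A trA; first by exists 0; apply: thinmx0.
have trq (q : {poly F}) k : \tr (horner_mx A q *m A ^+ k.+1) = 0.
  elim/poly_ind: q k => [|q c IHq] k; first by rewrite rmorph0 mul0mx linear0.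
  rewrite rmorphD rmorphM /= horner_mx_X horner_mx_C mulmxDl linearD /=.
  by rewrite mul_scalar_mx linearZ /= trA mulr0 addr0 -mulmxA mulmxE -exprS IHq.
have [a [p + charE]] := multiplicity_XsubC (char_poly A) 0.
rewrite monic_neq0 ?char_poly_monic //= -coprimepX => pX.
rewrite subr0 in charE.
have /Bezout_eq1_coprimepP[[u v] /= uv1] : coprimep p ('X^(a.+1)).
  exact: coprimep_expr.
pose E := horner_mx A (v * 'X^(a.+1)).
have pE : horner_mx A (p * 'X^a) = 0 by rewrite -charE Cayley_Hamilton.
have EE : E *m E = E.
  apply/eqP; rewrite -subr_eq0 -[X in _ - X]mulmx1 -mulmxBr.
  have -> : E - 1%:M = - horner_mx A (u * p).
    rewrite -[1%:M](rmorph1 (horner_mx A)) -uv1 rmorphD /= -/E.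
    by rewrite opprD addrCA subrr addr0.
  rewrite mulmxN oppr_eq0 /E mulmxE -rmorphM /= exprSr.
  have -> : v * ('X^a * 'X) * (u * p) = (p * 'X^a) * (v * 'X * u) by ring.
  by rewrite rmorphM /= pE mul0r.
have E0 : E = 0.
  apply/eqP; rewrite -mxrank_eq0 -(eqr_nat F) -(mxtrace_idempotent EE).
  by rewrite /E rmorphM rmorphXn /= horner_mx_X -mulmxE trq.
exists a; rewrite -[LHS]mulr1 -(rmorph1 (horner_mx A)) -uv1 rmorphD /= -/E E0.
rewrite addr0 -[A in A ^+ a]horner_mx_X -rmorphXn -rmorphM /=.
by rewrite mulrC -mulrA rmorphM /= pE mulr0.
Qed.

(** * Lie algebras in coordinates and the centralizer of the Reeb vector *)

Lemma mulmx_rV_eq0 (F : fieldType) m n (A : 'M[F]_(m, n)) :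
  (forall y : 'rV_m, y *m A = 0) -> A = 0.
Proof. by move=> A0; apply/row_matrixP => i; rewrite rowE A0 row0. Qed.

Lemma trmx11 (F : fieldType) (A : 'M[F]_1) : A^T = A.
Proof. by rewrite [A]mx11_scalar tr_scalar_mx. Qed.

(** A Lie bracket on row vectors is encoded by its adjoint matrices, with
    [x, y] = y *m adm x.  Matrices acting on the right compose in the reverse
    order, which explains the order of the factors in [adm_bracket], the
    Jacobi identity. *)
Record row_lie (F : fieldType) (n : nat) := RowLie {
  adm :> {linear 'rV[F]_n -> 'M[F]_n};
  adm_anti : forall x y, x *m adm y = - (y *m adm x);
  adm_bracket : forall x y,
    adm (y *m adm x) = adm y *m adm x - adm x *m adm y }.

Section RowLieTheory.
Variables (F : numFieldType) (n : nat) (L : row_lie F n).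
Implicit Types (x y w xi : 'rV[F]_n) (f phi e : 'cV[F]_n).

Lemma adm_self x : x *m L x = 0.
Proof.
apply/rowP => j; have := congr1 (fun u : 'rV_n => u 0 j) (adm_anti L x x).
rewrite !mxE => /eqP; rewrite -addr_eq0 -mulr2n mulrn_eq0 /= => /eqP.
exact.
Qed.

(** The Gram matrix of the bilinear map (x, y) |-> f [x, y], which is - d f. *)
Definition bracket_form f : 'M[F]_n := lin1_mx (trmx \o mulmxr f \o L).

Lemma mul_bracket_form x f : x *m bracket_form f = (L x *m f)^T.
Proof. by rewrite mul_rV_lin1. Qed.

Lemma bracket_form_anti f : (bracket_form f)^T = - bracket_form f.
Proof.
apply/eqP; rewrite -addr_eq0; apply/eqP/mulmx_rV_eq0 => x.
apply: trmx_inj; rewrite trmx0; apply: mulmx_rV_eq0 => y.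
rewrite mulmxDr linearD /= mulmxDr mul_bracket_form trmxK trmx_mul trmxK.
rewrite [y *m (bracket_form f *m _)]mulmxA mul_bracket_form -trmx_mul trmx11.
by rewrite !mulmxA adm_anti mulNmx addrN.
Qed.

(** By the Jacobi identity ad w acts on d f through its action on f. *)
Lemma bracket_form_derivation w f :
  L w *m bracket_form f + bracket_form f *m (L w)^T = bracket_form (L w *m f).
Proof.
apply/eqP; rewrite -subr_eq0; apply/eqP/mulmx_rV_eq0 => x.
rewrite mulmxBr mulmxDr !mulmxA !mul_bracket_form adm_bracket -trmx_mul.
by rewrite -linearD -linearB /= mulmxBl -!mulmxA subrK subrr linear0.
Qed.

Lemma comm_adm_centralizer xi x : x *m L xi = 0 -> comm_mx (L xi) (L x).
Proof.
move=> x0; apply/esym/eqP.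
by rewrite -subr_eq0 -adm_bracket x0 linear0.
Qed.

(** Since ad [x, y] is a commutator, this is the cyclicity of the trace. *)
Lemma mxtrace_mul_adm_bracket (Q : 'M[F]_n) x y :
  comm_mx Q (L x) -> \tr (Q *m L (y *m L x)) = 0.
Proof.
move=> Qx; rewrite adm_bracket mulmxBr linearB /= (mulmxA Q (L x)) Qx.
by rewrite -(mulmxA (L x)) (mxtrace_mulC (L x)) -mulmxA subrr.
Qed.

(** The linear form is y |-> tr (D^k ad y) / c with D = ad xi: an x commuting
    with xi has ad x commuting with D, so [mxtrace_mul_adm_bracket] applies. *)
Lemma exists_trace_covector k xi (c := \tr (L xi ^+ k.+1)) : c != 0 ->
  exists phi : 'cV[F]_n, xi *m phi = 1%:M /\
    forall x, x *m L xi = 0 -> L x *m phi = 0.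
Proof.
move=> c0; pose D := L xi.
pose phi : 'cV[F]_n := \col_i (c^-1 * \tr (D ^+ k *m L (delta_mx 0 i))).
have phiE x : x *m phi = (c^-1 * \tr (D ^+ k *m L x))%:M.
  rewrite [in RHS](row_sum_delta x) linear_sum mulmx_sumr linear_sum mulr_sumr.
  apply/matrixP => a b; rewrite !ord1 !mxE eqxx mulr1n.
  apply: eq_bigr => i _; rewrite !mxE linearZ /= -scalemxAr linearZ /=.
  by rewrite mulrCA.
exists phi; split; first by rewrite phiE mulmxE -exprSr mulVf.
move=> x x0; apply: mulmx_rV_eq0 => y; rewrite mulmxA phiE.
rewrite mxtrace_mul_adm_bracket ?mulr0 ?scalar_mx0 ?raddf0 //.
apply/comm_mx_sym; rewrite comm_mxE; apply: commrX.
exact/esym/comm_adm_centralizer.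
Qed.

Section Contact.
Variables (e : 'cV[F]_n) (xi : 'rV[F]_n).
Hypotheses (xi_e : xi *m e = 1%:M) (adm_xi_e : L xi *m e = 0).
Hypothesis nondeg : forall x, x *m e = 0 -> L x *m e = 0 -> x = 0.
Hypothesis tr0 : forall x, x *m L xi = 0 -> x *m e = 0 -> \tr (L x) = 0.

(** If x commutes with xi, then d phi vanishes on x, that is, d (eta - phi)
    and d eta agree on x; if moreover eta x = 0, then x is a fixed vector of
    the operator T which expresses d (eta - phi) through d eta.  Unimodularity
    on the centralizer makes T nilpotent. *)
Lemma centralizer_reeb k x : \tr (L xi ^+ k.+1) != 0 ->
  x *m L xi = 0 -> x *m e = 0 -> x = 0.
Proof.
move=> /exists_trace_covector[phi [xi_phi phi0]] xD xe.
pose B := bracket_form; pose Theta := e *m e^T + B e.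
have [f fE] : exists f, f = e - phi by exists (e - phi).
have BE y g : y *m B g = (L y *m g)^T by exact: mul_bracket_form.
have xi_phi0 : L xi *m phi = 0 by apply/phi0/adm_self.
have xi_f0 : L xi *m f = 0 by rewrite fE mulmxBr adm_xi_e xi_phi0 subrr.
have xif : xi *m f = 0 by rewrite fE mulmxBr xi_e xi_phi subrr.
have trx1 (a : 'rV[F]_n) (b : 'cV[F]_n) : b^T *m a^T = a *m b.
  by rewrite -trmx_mul trmx11.
have Bxi g : L xi *m g = 0 -> B g *m xi^T = 0.
  move=> g0; apply: trmx_inj.
  by rewrite trmx_mul trmxK bracket_form_anti mulmxN BE g0 !trmx0 oppr0.
have Theta_xi : Theta *m xi^T = e.
  by rewrite mulmxDl -mulmxA trx1 xi_e mulmx1 Bxi // addr0.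
have xi_Theta : xi *m Theta = e^T.
  by rewrite mulmxDr mulmxA xi_e mul1mx BE adm_xi_e trmx0 addr0.
have Theta_unit : Theta \in unitmx.
  rewrite -row_free_unit; apply: inj_row_free => y y0.
  have ye : y *m e = 0 by rewrite -Theta_xi mulmxA y0 mul0mx.
  apply: nondeg => //; apply: trmx_inj; rewrite -BE trmx0.
  by move: y0; rewrite mulmxDr mulmxA ye mul0mx add0r.
pose G := invmx Theta.
have eG : e^T *m G = xi by rewrite -xi_Theta mulmxK.
have Ge : G *m e = xi^T by rewrite -Theta_xi mulKmx.
(* The coadjoint action of w maps eta to f, f to f and phi to 0. *)
pose w := f^T *m G; pose A := L w.
have we : w *m e = 0 by rewrite -mulmxA Ge trx1 xif.
have Ae : A *m e = f.
  apply: trmx_inj; rewrite -BE.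
  have : w *m Theta = f^T by rewrite mulmxKV.
  by rewrite mulmxDr mulmxA we mul0mx add0r.
have wD : w *m L xi = 0.
  apply: nondeg; first by rewrite -mulmxA adm_xi_e mulmx0.
  by rewrite adm_bracket mulmxBl -!mulmxA adm_xi_e Ae xi_f0 mulmx0 subrr.
have Af : A *m f = f by rewrite {1}fE mulmxBr Ae phi0 // subr0.
have trA : \tr A = 0 by exact: tr0.
have De : A *m B e + B e *m A^T = B f.
  by rewrite bracket_form_derivation Ae.
have Df : A *m B f + B f *m A^T = B f.
  by rewrite bracket_form_derivation Af.
(* Theta is B e made invertible by a rank-one term, which disappears
   against T since T *m e = 0. *)
have [T TE] : exists T, T = B f *m G by exists (B f *m G).
have TTheta : T *m Theta = B f by rewrite TE mulmxKV.
have xiT : xi *m T = 0 by rewrite TE mulmxA BE xi_f0 trmx0 mul0mx.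
have Te : T *m e = 0 by rewrite TE -mulmxA Ge Bxi.
have TBe : T *m B e = B f.
  by rewrite -TTheta mulmxDr mulmxA Te mul0mx add0r.
(* The two derivation identities say that [A, T] = T - T^2 modulo the line
   of xi; this correction is invisible to the traces against powers of T,
   because xi *m T = 0. *)
pose X := A *m T - T *m A + T *m T - T.
have Xxi : X = - (T *m f *m xi).
  have XBe : X *m B e = 0.
    rewrite !(mulmxBl, mulmxDl) -!mulmxA TBe.
    have -> : A *m B e = B f - B e *m A^T by rewrite -De addrK.
    rewrite mulmxBr (mulmxA T (B e)) TBe -{5}Df.
    move: (T *m B f) (A *m B f) (B f *m A^T) => a b c.
    by rewrite opprB addrA subrK subrr.
  have Xe : X *m e = - (T *m f).
    rewrite mulmxBl mulmxDl mulmxBl -!mulmxA Te !mulmx0 Ae.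
    by rewrite sub0r addr0 subr0.
  have -> : X = X *m Theta *m G by rewrite mulmxK.
  by rewrite mulmxDr XBe addr0 mulmxA Xe -mulmxA eG mulNmx.
have trTS m : \tr (T ^+ m.+2) = \tr (T ^+ m.+1).
  have : \tr (T ^+ m *m X) = 0.
    rewrite Xxi mulmxN linearN /= mulmxA mxtrace_mulC !mulmxA.
    have -> : xi *m T ^+ m *m T = 0.
      by rewrite -mulmxA mulmxE -exprSr exprS -mulmxE mulmxA xiT mul0mx.
    by rewrite mul0mx linear0 oppr0.
  rewrite !(mulmxBr, mulmxDr) !(linearB, linearD) /=.
  rewrite (mulmxA _ A) (mxtrace_mulC (T ^+ m *m A)) !mulmxA.
  rewrite -[T *m T ^+ m]/(T * T ^+ m) -exprS.
  rewrite -[T ^+ m *m T]/(T ^+ m * T) -exprSr.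
  rewrite subrr add0r -[T ^+ m.+1 *m T]/(T ^+ m.+1 * T) -exprSr.
  by move/eqP; rewrite subr_eq0 => /eqP.
have trT1 : \tr T = 0.
  have ATheta : A *m Theta + Theta *m A^T = B f + (f *m e^T + e *m f^T).
    rewrite mulmxDr mulmxDl (mulmxA A e) Ae -(mulmxA e) -trmx_mul Ae -De.
    by rewrite addrACA addrC.
  have : \tr ((A *m Theta + Theta *m A^T) *m G) = 0.
    rewrite mulmxDl mulmxK // linearD /= trA mxtrace_mulC mulKmx //.
    by rewrite mxtrace_tr trA addr0.
  rewrite ATheta 2!mulmxDl !linearD /= -TE -mulmxA eG mxtrace_mulC xif linear0.
    by rewrite -mulmxA mxtrace_mulC we linear0 !addr0.
have [m Tm] : exists m, T ^+ m = 0.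
  by apply: nilpotent_of_mxtrace; elim=> [|m IHm]; rewrite ?trTS ?expr1.
have xT : x *m T = x.
  rewrite TE mulmxA BE fE mulmxBr (phi0 _ xD) subr0 -BE.
  have -> : x *m B e = x *m Theta by rewrite mulmxDr mulmxA xe mul0mx add0r.
  by rewrite mulmxK.
have : x *m T ^+ m = x.
  by elim: m {Tm} => [|m IHm]; rewrite ?mulmx1 // exprS -mulmxE mulmxA xT.
by rewrite Tm mulmx0.
Qed.
End Contact.
End RowLieTheory.

(** * Spectra, moduli and multiplicities *)

Lemma char_poly_uconj (F : fieldType) n (P A : 'M[F]_n) :
  P \in unitmx -> char_poly (P *m A *m invmx P) = char_poly A.
Proof.
move=> Pu; rewrite /char_poly.
pose c (B : 'M[F]_n) : 'M[{poly F}]_n := map_mx polyC B.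
have PV : c P *m c (invmx P) = 1%:M by rewrite /c -map_mxM mulmxV // map_mx1.
have -> : char_poly_mx (P *m A *m invmx P) =
    c P *m char_poly_mx A *m c (invmx P).
  rewrite /char_poly_mx mulmxBr mulmxBl !map_mxM; congr (_ - _).
  by rewrite scalar_mxC -mulmxA PV mulmx1.
rewrite !det_mulmx mulrC mulrA -det_mulmx.
by rewrite (mulmx1C PV) det1 mul1r.
Qed.

Lemma horner_mx_trig (F : fieldType) n (A : 'M[F]_n.+1) (q : {poly F}) :
  is_trig_mx A ->
  is_trig_mx (horner_mx A q) /\ forall i, horner_mx A q i i = q.[A i i].
Proof.
move=> /is_trig_mxP trA; elim/poly_ind: q => [|q c [/is_trig_mxP trq diagq]].
  by rewrite rmorph0; split=> [|i]; rewrite ?mx0_is_trig // mxE horner0.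
rewrite rmorphD rmorphM /= horner_mx_X horner_mx_C.
have mulE (i j : 'I_n.+1) : (i <= j)%N ->
    (horner_mx A q * A) i j = if i == j then q.[A i i] * A i i else 0.
  move=> le_ij; rewrite mxE (bigD1 i) //= diagq big1 => [|k neq_ki].
    rewrite addr0; case: eqVneq => [->//|neq_ij].
    by rewrite (trA i j) ?mulr0 // ltn_neqAle neq_ij.
  have [lt_ik|le_ki] := ltnP i k; first by rewrite trq ?mul0r.
  rewrite (trA k j) ?mulr0 // (leq_trans _ le_ij) // ltn_neqAle le_ki andbT.
  exact: neq_ki.
split=> [|i]; last by rewrite mxE mulE // eqxx !mxE eqxx hornerMXaddC.
apply/is_trig_mxP => i j lt_ij; rewrite mxE mulE ?(ltnW lt_ij) // mxE.
rewrite (_ : (i == j) = false) ?addr0 //.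
by apply/negbTE; rewrite neq_ltn lt_ij.
Qed.

(** By Schur triangularization; ds is the diagonal, so that it lists the
    eigenvalues with their algebraic multiplicities. *)
Lemma exists_spectrum (C : numClosedFieldType) n (D : 'M[C]_n.+1) :
  exists ds : seq C,
    [/\ size ds = n.+1, char_poly D = \prod_(d <- ds) ('X - d%:P)
      & forall q, \tr (horner_mx D q) = \sum_(d <- ds) q.[d]].
Proof.
have [P /unitarymx_unit Pu] := Schur D (ltn0Sn n).
rewrite /similar_to /= conjumx //; set T := _ *m _ => trT.
exists [seq T i i | i : 'I_n.+1]; split.
- by rewrite size_map size_enum_ord.
- by rewrite -(char_poly_uconj D Pu) char_poly_trig // big_map big_enum.
move=> q; rewrite big_map big_enum /=.
have [_ diagq] := horner_mx_trig q trT.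
rewrite -(eq_bigr _ (fun i _ => diagq i)) -/(mxtrace _) /T horner_mx_uconj //.
by rewrite mxtrace_mulC mulKmx.
Qed.

Lemma size_count3 (T : eqType) (a b c : T) (s : seq T) :
  uniq [:: a; b; c] -> {subset s <= [:: a; b; c]} ->
  size s = (count_mem a s + count_mem b s + count_mem c s)%N.
Proof.
rewrite /= !inE negb_or !andbT => /andP[/andP[/negPf ab /negPf ac] /negPf bc].
elim: s => //= x s IHs sub.
rewrite IHs => [|y ys]; last by apply: sub; rewrite inE ys orbT.
have := sub x (mem_head _ _); rewrite !inE => /or3P[]/eqP->.
- by rewrite eqxx ab ac; lia.
- by rewrite eqxx [b == a]eq_sym ab bc; lia.
- by rewrite eqxx [c == a]eq_sym [c == b]eq_sym ac bc; lia.
Qed.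

Lemma normC_parallelogram (C : numClosedFieldType) (a b : C) :
  `|a + b| ^+ 2 + `|a - b| ^+ 2 = 2 * (`|a| ^+ 2 + `|b| ^+ 2).
Proof. by rewrite !normCK rmorphD rmorphB /=; ring. Qed.

Lemma seq_max_norm (C : numClosedFieldType) (s : seq C) (a : C) : a \in s ->
  exists2 b, b \in s & forall c, c \in s -> `|c| <= `|b|.
Proof.
elim: s a => // d s IHs a _; case: s IHs => [|d' s] IHs.
  by exists d; rewrite ?mem_head // => c; rewrite inE => /eqP->.
have [b bs bP] := IHs d' (mem_head _ _).
have [ledb|ltbd] := real_leP (normr_real d) (normr_real b).
  exists b; first by rewrite inE bs orbT.
  by move=> c; rewrite inE => /predU1P[->|/bP].
exists d; first exact: mem_head.
by move=> c; rewrite inE => /predU1P[->|/bP/le_trans] //; apply; apply: ltW.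
Qed.

(** * The spectrum of the Reeb vector *)

Section ReebSpectrum.
Variables (C : numClosedFieldType) (n : nat) (L : row_lie C n.+1).
Variables (e : 'cV[C]_n.+1) (xi : 'rV[C]_n.+1).
Implicit Types (x y u v : 'rV[C]_n.+1) (p q : {poly C}) (la mu nu : C).
Hypotheses (xi_e : xi *m e = 1%:M) (adm_xi_e : L xi *m e = 0).
Hypothesis nondeg : forall x, x *m e = 0 -> L x *m e = 0 -> x = 0.
Hypothesis centralizer0 : forall x, x *m L xi = 0 -> x *m e = 0 -> x = 0.
Let D := L xi.
Variable ds : seq C.
Hypotheses (size_ds : size ds = n.+1)
  (char_ds : char_poly D = \prod_(d <- ds) ('X - d%:P))
  (tr_ds : forall q, \tr (horner_mx D q) = \sum_(d <- ds) q.[d]).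

Lemma horner_reeb_e q : horner_mx D q *m e = q.[0] *: e.
Proof.
elim/poly_ind: q => [|q c IHq]; first by rewrite rmorph0 mul0mx horner0 scale0r.
rewrite rmorphD rmorphM /= horner_mx_X horner_mx_C mulmxDl -mulmxA adm_xi_e.
by rewrite mulmx0 add0r mul_scalar_mx hornerMXaddC mulr0 add0r.
Qed.

(** The constant term 1 controls the component along xi.  On ker eta the
    operator D is injective, so that a vector killed by a power of D and
    lying in ker eta is 0. *)
Lemma horner_reeb_projector q m :
  q.[0] = 1 -> horner_mx D ('X^m * q) = 0 -> horner_mx D q = e *m xi.
Proof.
move=> q01 qX; apply/eqP; rewrite -subr_eq0; apply/eqP/mulmx_rV_eq0 => y.
pose z := y *m (horner_mx D q - e *m xi).
have ze : z *m e = 0.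
  rewrite /z mulmxBr mulmxBl -!mulmxA horner_reeb_e q01 scale1r xi_e mulmx1.
  by rewrite subrr.
have qXD : horner_mx D q *m D ^+ m = 0.
  have <- : horner_mx D 'X^m = D ^+ m by rewrite rmorphXn /= horner_mx_X.
  by rewrite mulmxE -rmorphM mulrC.
have zD : z *m D ^+ m.+1 = 0.
  rewrite /z mulmxBr mulmxBl exprS -mulmxE -!mulmxA (mulmxA xi) adm_self.
  rewrite mul0mx !mulmx0 subr0 mulmxE -exprS exprSr -mulmxE (mulmxA _ _ D) qXD.
  by rewrite mul0mx mulmx0.
rewrite -/z; elim: m zD {qX qXD} => [|m IHm].
  by rewrite expr1 => zD; apply: centralizer0.
rewrite exprSr -mulmxE mulmxA => zD; apply: IHm; apply: centralizer0 => //.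
by rewrite exprSr -mulmxE -!mulmxA adm_xi_e !mulmx0.
Qed.

Let avoid nu := \prod_(d <- ds | d != nu) ('X - (d - nu)%:P).
Let avoids (Ls : seq C) := \prod_(nu <- Ls) avoid nu.
(** One polynomial serves for all nu in Ls: translated by nu, it takes the
    value 1 at nu and vanishes at the other eigenvalues of D, with their
    multiplicities.  Evaluated at D, this translate plays the part of the
    projector onto the generalized eigenspace of nu. *)
Definition spectral_poly Ls := (avoids Ls).[0]^-1 *: avoids Ls.

Lemma avoids0_neq0 Ls : (avoids Ls).[0] != 0.
Proof.
rewrite horner_prod prodf_seq_neq0; apply/allP => nu _ /=.
rewrite horner_prod prodf_seq_neq0; apply/allP => d _; apply/implyP => neq_d.
by rewrite !hornerE oppr_eq0 subr_eq0.
Qed.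

Lemma spectral_poly0 Ls : (spectral_poly Ls).[0] = 1.
Proof. by rewrite hornerZ mulVf ?avoids0_neq0. Qed.

Lemma spectral_polyE Ls nu d : nu \in Ls -> d \in ds ->
  (spectral_poly Ls).[d - nu] = (d == nu)%:R.
Proof.
move=> nuL dds; case: eqVneq => [->|neq_d].
  by rewrite subrr spectral_poly0.
rewrite hornerZ; suff -> : (avoids Ls).[d - nu] = 0 by rewrite mulr0.
rewrite /avoids (big_rem nu) //= hornerM /avoid horner_prod.
rewrite (big_rem d) //= neq_d hornerXsubC.
by rewrite subrr !mul0r.
Qed.

Lemma spectral_poly_shift Ls nu : nu \in Ls ->
  \prod_(d <- ds | d != nu) ('X - d%:P) %| spectral_poly Ls \Po ('X - nu%:P).
Proof.
move=> nuL; rewrite comp_polyZ dvdpZr ?invr_eq0 ?avoids0_neq0 //.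
rewrite /avoids (big_rem nu nuL) /= comp_polyM; apply: dvdp_mulr.
rewrite /avoid rmorph_prod /=.
rewrite [X in _ %| X](eq_bigr (fun d => 'X - d%:P)) // => d _.
rewrite comp_polyB comp_polyX comp_polyC -addrA -opprD -polyCD.
by rewrite [nu + _]addrC subrK.
Qed.

Lemma horner_dvd_char q : char_poly D %| q -> horner_mx D q = 0.
Proof.
by move=> /dvdpP[r ->]; rewrite rmorphM /= Cayley_Hamilton mulr0.
Qed.

Lemma horner_spectral_poly Ls : 0 \in Ls ->
  horner_mx D (spectral_poly Ls) = e *m xi.
Proof.
move=> L0; apply: (@horner_reeb_projector _ (count_mem 0 ds)).
  exact: spectral_poly0.
apply: horner_dvd_char; rewrite char_ds (bigID (pred1 0)) /=.
apply: dvdp_mul; last first.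
  by have := spectral_poly_shift L0; rewrite subr0 comp_polyXr.
rewrite (eq_bigr (fun=> 'X)) => [|d /eqP->]; last by rewrite subr0.
by rewrite big_const_seq iter_mulr_1.
Qed.

Lemma count_mem0_spectrum : count_mem 0 ds = 1%N.
Proof.
apply/eqP; rewrite -(eqr_nat C) -(mxtrace1 C 1) -xi_e mxtrace_mulC.
rewrite -(horner_spectral_poly (mem_head 0 [::])) tr_ds -sum1_count natr_sum.
rewrite big_mkcond /= !big_seq; apply/eqP/eq_bigr => d dds.
rewrite -[in RHS](subr0 d) spectral_polyE ?mem_head //.
by case: eqP.
Qed.

(** The form x |-> tr (q(D) ad x) vanishes on the image of D, and every x
    differs from eta(x) xi by an element of this image: the polynomial
    1 - q0, where q0(D) is the projector onto the line of xi, is a multiple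
    of X. *)
Lemma mxtrace_horner_adm q x :
  \tr (horner_mx D q *m L x) = \tr (horner_mx D q *m D) * (x *m e) 0 0.
Proof.
pose q0 := spectral_poly [:: 0].
have /dvdpP[r q0r] : 'X %| 1 - q0.
  rewrite -['X]subr0 -polyC0 dvdp_XsubCl rootE hornerD hornerN.
  by rewrite spectral_poly0 hornerC subrr.
have rD : horner_mx D r *m D = 1%:M - e *m xi.
  rewrite -[X in _ *m X](horner_mx_X D) mulmxE -rmorphM /= -q0r rmorphB rmorph1.
  by rewrite /q0 /= horner_spectral_poly ?mem_head.
have xE : x = (x *m e) 0 0 *: xi + x *m horner_mx D r *m D.
  rewrite -mulmxA rD mulmxBr mulmx1 mulmxA.
  by rewrite [x *m e]mx11_scalar mul_scalar_mx mxE eqxx mulr1n addrC subrK.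
rewrite {1}xE linearD linearZ /= mulmxDr linearD /= -scalemxAr linearZ /=.
rewrite mxtrace_mul_adm_bracket ?addr0 1?mulrC //.
exact/comm_horner_mx.
Qed.

(** Bracketing with the eigenvector v shifts the spectrum of D by la, since
    [D, ad v] = - la ad v. *)
Lemma adm_eigen_horner la v q : v *m D = - la *: v ->
  L v *m horner_mx D q = horner_mx D (q \Po ('X - la%:P)) *m L v.
Proof.
move=> vD.
have LD : L v *m D = (D - la%:M) *m L v.
  have := adm_bracket L xi v; rewrite vD linearZ /= => /eqP.
  rewrite eq_sym subr_eq => /eqP ->.
  by rewrite mulmxBl mul_scalar_mx scaleNr addrC.
elim/poly_ind: q => [|q c IHq].
  by rewrite comp_poly0 !rmorph0 mulmx0 mul0mx.
rewrite comp_polyD comp_polyM comp_polyX comp_polyC !rmorphD !rmorphM /=.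
rewrite rmorphB /= horner_mx_X !horner_mx_C mulmxDr mulmxDl mulmxA IHq.
by rewrite -mulmxA LD mulmxA scalar_mxC.
Qed.

(** Think of t nu as the trace of ad u ad v on the generalized eigenspace
    of nu, where v is an eigenvector for - la and eta [u, v] = 1.  As ad v
    maps the eigenspace of nu + la to that of nu, the difference
    t nu - t (nu + la) is the trace of ad [u, v] there, which is that of D by
    [mxtrace_horner_adm].  The eigenspace of 0 is the line of xi, on which
    [u, [v, xi]] = la [u, v] gives the initial value. *)
Lemma eigen_string la (Ls : seq C) : la != 0 -> - la \in ds -> 0 \in Ls ->
  exists t : C -> C, t 0 = la /\
    forall nu, nu \in Ls -> (nu \notin ds -> t nu = 0) /\
      t nu - t (nu + la) = nu * (count_mem nu ds)%:R.
Proof.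
move=> la0 lads L0.
have /eigenvalueP[v vD v0] : eigenvalue D (- la).
  by rewrite eigenvalue_root_char char_ds root_prod_XsubC.
have ve : v *m e = 0.
  have : v *m D *m e = 0 by rewrite -mulmxA adm_xi_e mulmx0.
  rewrite vD -scalemxAl => /eqP.
  by rewrite scaler_eq0 oppr_eq0 (negPf la0) => /eqP.
have [u uve] : exists u, v *m L u *m e = 1%:M.
  have [M ME] : exists M, M = L v *m e by exists (L v *m e).
  have : M != 0 by rewrite ME; apply: contra_neq v0; exact: nondeg.
  case/matrix0Pn => i [j]; rewrite ord1 => c0.
  exists (- (M i 0)^-1 *: delta_mx 0 i).
  rewrite adm_anti -scalemxAl scaleNr opprK -scalemxAl -mulmxA -ME -rowE.
  by apply/matrixP => a b; rewrite !ord1 !mxE eqxx mulVf.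
pose tau q := \tr (horner_mx D q *m (L v *m L u)).
pose q0 := spectral_poly Ls.
have tau_shift q : tau q - tau (q \Po ('X - la%:P)) = \sum_(d <- ds) q.[d] * d.
  have -> : \sum_(d <- ds) q.[d] * d = \tr (horner_mx D q *m D).
    rewrite -[X in _ *m X]horner_mx_X mulmxE -rmorphM /= tr_ds.
    by apply: eq_bigr => d _; rewrite hornerMX.
  have := mxtrace_horner_adm q (v *m L u); rewrite uve mxE eqxx mulr1 => <-.
  rewrite adm_bracket mulmxBr linearB /=; congr (_ - _).
  rewrite /tau [in LHS](mulmxA _ (L v)) -adm_eigen_horner //.
  by rewrite -[in LHS]mulmxA [in LHS]mxtrace_mulC -[in LHS]mulmxA.
exists (fun nu => tau (q0 \Po ('X - nu%:P))); split.
  rewrite subr0 comp_polyXr /tau /q0 horner_spectral_poly // -mulmxA.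
  rewrite mxtrace_mulC !mulmxA.
  have -> : xi *m L v = la *: v by rewrite adm_anti vD scaleNr opprK.
  by rewrite -!scalemxAl uve linearZ /= mxtrace1 mulr1.
move=> nu nuL; split=> [nuds|].
  rewrite /tau horner_dvd_char ?mul0mx ?linear0 // char_ds.
  have := spectral_poly_shift nuL.
  rewrite big_seq_cond (eq_bigl (fun d => d \in ds)).
    by rewrite -big_seq.
  by move=> d /=; case: eqVneq => [->|]; rewrite ?(negPf nuds) ?andbF ?andbT.
have -> : q0 \Po ('X - (nu + la)%:P) = (q0 \Po ('X - nu%:P)) \Po ('X - la%:P).
  rewrite -comp_polyA comp_polyB comp_polyX comp_polyC polyCD opprD.
  by rewrite addrAC addrA.
rewrite tau_shift big_seq.
rewrite (eq_bigr (fun d => (d == nu)%:R * nu)); last first.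
  move=> d dds; rewrite horner_comp hornerXsubC /q0 spectral_polyE //.
  by case: eqVneq => [->|]; rewrite ?mul0r.
by rewrite -big_seq -mulr_suml mulrC -natr_sum -sum1_count [in RHS]big_mkcond.
Qed.

(** If - mu were missing, the string from 0 to - mu would give
    t 0 = t (- mu) = 0, whereas t 0 = - mu. *)
Lemma spectrum_oppr mu : mu \in ds -> - mu \in ds.
Proof.
have [->|mu0] := eqVneq mu 0; first by rewrite oppr0.
move=> muds; apply: contraT => nds.
have nmu0 : - mu != 0 by rewrite oppr_eq0.
have muds' : - - mu \in ds by rewrite opprK.
have [t [t0 tP]] :=
  @eigen_string (- mu) [:: 0; - mu] nmu0 muds' (mem_head _ _).
have [_] := tP 0 (mem_head _ _); rewrite add0r mul0r t0.
have [/(_ nds)-> _] := tP (- mu) (mem_last _ [:: _]).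
by move/eqP; rewrite subr0 oppr_eq0 (negPf mu0).
Qed.

Lemma spectrum_bound mu : mu != 0 -> exists2 k, (2 < k)%N & k%:R * mu \notin ds.
Proof.
move=> mu0; pose s' := [seq k%:R * mu | k <- iota 3 n.+2].
have [/allP sub|/allPn[_ /mapP[k + ->] nds]] := boolP (all (mem ds) s').
  have /uniq_leq_size : uniq s'.
    rewrite map_inj_uniq ?iota_uniq // => i j /(mulIf mu0) /eqP.
    by rewrite eqr_nat => /eqP.
  by move=> /(_ _ sub); rewrite size_map size_iota size_ds ltnn.
by rewrite mem_iota => /andP[le3k _]; exists k.
Qed.

(** Let m(k) be the multiplicity of k mu and let K mu be a multiple of mu
    outside the spectrum.  Summing the recurrence from 0 to K mu yields
    m(1) + 2 m(2) + 3 m(3) + ... = 1. *)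
Lemma spectrum_simple mu : mu != 0 -> mu \in ds ->
  count_mem mu ds = 1%N /\ 2 * mu \notin ds.
Proof.
move=> mu0 muds; have [K gtK nK] := spectrum_bound mu0.
pose Ls := [seq k%:R * mu | k <- iota 0 K.+1].
have inL k : (k <= K)%N -> k%:R * mu \in Ls.
  by move=> leK; apply: (map_f (fun k => k%:R * mu)); rewrite mem_iota.
have L0 : 0 \in Ls by rewrite -[0](mul0r mu) (inL 0).
have [t [t0 tP]] := eigen_string mu0 (spectrum_oppr muds) L0.
pose m k := count_mem (k%:R * mu) ds.
have tE k : (k <= K)%N ->
    t 0 - t (k%:R * mu) = mu * (\sum_(i < k) i * m i)%:R.
  elim: k => [|k IHk] ltk; first by rewrite mul0r subrr big_ord0 mulr0.
  rewrite big_ord_recr /= natrD mulrDr -IHk ?(ltnW ltk) //.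
  have [_] := tP _ (inL k (ltnW ltk)).
  have -> : k%:R * mu + mu = k.+1%:R * mu by rewrite -natr1 mulrDl mul1r.
  rewrite -/(m k) => tk.
  by rewrite natrM mulrA [mu * _]mulrC -tk addrA subrK.
have := tE K (leqnn K); have [/(_ nK)-> _] := tP _ (inL K (leqnn K)).
rewrite t0 subr0 -[LHS]mulr1 => /(mulfI mu0)/eqP.
rewrite eq_sym pnatr_eq1.
case: K gtK {nK Ls inL L0 t t0 tP tE} => [|[|[|K]]] // _.
have m1 : (0 < m 1)%N by rewrite /m mul1r -has_count has_pred1.
rewrite !big_ord_recl /= -[bump 0 (bump 0 0)]/2%N -[bump 0 0]/1%N => sum1.
have m1E : m 1%N = 1%N by lia.
have m2E : m 2%N = 0%N by lia.
split; first by move: m1E; rewrite /m mul1r.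
by rewrite -has_pred1 has_count -/(m 2) m2E.
Qed.

(** If la + mu is missing, then so is mu - 2 la, whose modulus exceeds that of
    la by the parallelogram law.  The string through mu - la and mu then
    reduces to mu + m (mu - la) = 0, where m is the multiplicity of mu - la, at
    most 1: either mu = 0, or la = 2 mu is the double of an eigenvalue. *)
Lemma max_eigenvalue_string la mu :
  (forall d, d \in ds -> `|d| <= `|la|) -> la \in ds -> la != 0 ->
  mu \in ds -> mu != 0 -> mu != la -> la + mu \in ds.
Proof.
move=> maxla lads la0 muds mu0 mula; apply: contraT => nsum.
have ndiff : mu - 2 * la \notin ds.
  apply/negP => /maxla le1; have le2 := maxla _ muds.
  have := normC_parallelogram la (la - mu).
  have -> : la + (la - mu) = - (mu - 2 * la) by ring.
  have -> : la - (la - mu) = mu by ring.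
  rewrite normrN => E.
  have : `|mu - 2 * la| ^+ 2 <= `|la| ^+ 2 by rewrite lerXn2r ?nnegrE.
  have : `|mu| ^+ 2 <= `|la| ^+ 2 by rewrite lerXn2r ?nnegrE.
  have : 0 < `|la - mu| ^+ 2 by rewrite exprn_gt0 // normr_gt0 subr_eq0 eq_sym.
  move=> h1 h2 h3; have := lerD h3 h2; rewrite E mulrDr -mulr2n mulr_natl.
  by rewrite gerDl pmulr_rle0 ?ltr0n // lt_geF.
pose Ls := [:: 0; mu; mu - la; mu - 2 * la; la + mu].
have [t [t0 tP]] := @eigen_string la Ls la0 (spectrum_oppr lads) (mem_head _ _).
have [|_ t1] := tP mu; first by rewrite !inE eqxx orbT.
have [|/(_ nsum) t2 _] := tP (la + mu); first by rewrite !inE eqxx !orbT.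
have [|_ t3] := tP (mu - la); first by rewrite !inE eqxx !orbT.
have [|/(_ ndiff) t4 t5] := tP (mu - 2 * la); first by rewrite !inE eqxx !orbT.
have c0 : count_mem (mu - 2 * la) ds = 0%N by apply/count_memPn.
have Esub : mu - 2 * la + la = mu - la by ring.
rewrite c0 mulr0 t4 sub0r Esub in t5.
have [m1 m2] := spectrum_simple mu0 muds.
rewrite m1 mulr1 [mu + la]addrC t2 subr0 in t1.
rewrite subrK t1 -[t (mu - la)]opprK t5 oppr0 sub0r in t3.
have [subds|nsub] := boolP (mu - la \in ds); last first.
  have nsub0 : count_mem (mu - la) ds = 0%N by apply/count_memPn.
  by move/eqP: t3; rewrite nsub0 mulr0 oppr_eq0 (negPf mu0).
have sub0 : mu - la != 0 by rewrite subr_eq0.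
have [n1 _] := spectrum_simple sub0 subds.
move: t3; rewrite n1 mulr1 => t3.
have laE : la = 2 * mu.
  rewrite mulr_natl mulr2n; apply/eqP.
  by rewrite -subr_eq -opprB -t3 opprK.
by rewrite -laE lads in m2.
Qed.

(** For la of maximal modulus, an eigenvalue mu other than 0, la and - la
    would make both la + mu and la - mu eigenvalues, although one of them is
    longer than la. *)
Theorem reeb_spectrum_dim d : d \in ds -> d != 0 -> n.+1 = 3%N.
Proof.
move=> dds d0; have [la lads maxla] := seq_max_norm dds.
have la0 : la != 0.
  by apply: contraNneq d0 => la0; rewrite -normr_le0 -(normr0 C) -la0 maxla.
have all3 mu : mu \in ds -> mu \in [:: 0; la; - la].
  move=> muds; rewrite !inE; apply: contraT.
  rewrite !negb_or => /and3P[mu0 mula muNla].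
  have s1 := max_eigenvalue_string maxla lads la0 muds mu0 mula.
  have s2 : la - mu \in ds.
    apply: max_eigenvalue_string => //; first exact: spectrum_oppr.
      by rewrite oppr_eq0.
    by rewrite eqr_oppLR.
  have := normC_parallelogram la mu.
  have : `|la + mu| ^+ 2 <= `|la| ^+ 2 by rewrite lerXn2r ?nnegrE ?maxla.
  have : `|la - mu| ^+ 2 <= `|la| ^+ 2 by rewrite lerXn2r ?nnegrE ?maxla.
  have : 0 < `|mu| ^+ 2 by rewrite exprn_gt0 // normr_gt0.
  move=> h1 h2 h3 E; have := lerD h3 h2.
  rewrite E mulrDr -mulr2n mulr_natl.
  by rewrite gerDl pmulr_rle0 ?ltr0n // lt_geF.
have [m1 _] := spectrum_simple la0 lads.
have nla0 : - la != 0 by rewrite oppr_eq0.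
have [m2 _] := spectrum_simple nla0 (spectrum_oppr lads).
have laN : la != - la by rewrite -addr_eq0 -mulr2n mulrn_eq0.
rewrite -size_ds (size_count3 _ all3) /=; last first.
  by rewrite !inE negb_or ![0 == _]eq_sym la0 nla0 laN.
by rewrite count_mem0_spectrum m1 m2.
Qed.
End ReebSpectrum.

(** * Extension of scalars *)

Lemma row_vector_ind (F : pzRingType) n (P : 'rV[F]_n -> Prop) :
  P 0 -> (forall i, P (delta_mx 0 i)) ->
  (forall a x y, P x -> P y -> P (a *: x + y)) -> forall x, P x.
Proof.
move=> P0 Pdelta Plin x; rewrite (row_sum_delta x).
by elim/big_rec: _ => // i y _ Py; apply: Plin.
Qed.

Section ScalarExtension.
Variables (F K : numFieldType) (f : {rmorphism F -> K}) (n : nat).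
Variable L : row_lie F n.
Local Notation "A ^f" := (map_mx f A) : ring_scope.

Definition extended_adm (z : 'rV[K]_n) : 'M[K]_n :=
  \sum_i z 0 i *: (L (delta_mx 0 i))^f.

Lemma extended_adm_linear : linear extended_adm.
Proof.
move=> a x y; rewrite /extended_adm scaler_sumr -big_split.
apply: eq_bigr => i _; by rewrite !mxE scalerDl scalerA.
Qed.
HB.instance Definition _ :=
  GRing.isLinear.Build K 'rV[K]_n 'M[K]_n *:%R extended_adm extended_adm_linear.

Lemma extended_adm_delta i : extended_adm (delta_mx 0 i) = (L (delta_mx 0 i))^f.
Proof.
rewrite /extended_adm (bigD1 i) //= mxE !eqxx scale1r.
rewrite big1 ?addr0 // => j neq_ji.
by rewrite mxE (negPf neq_ji) andbF scale0r.
Qed.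

Lemma extended_adm_map x : extended_adm x^f = (L x)^f.
Proof.
rewrite [in RHS](row_sum_delta x) linear_sum raddf_sum.
apply: eq_bigr => i _ /=.
by rewrite linearZ map_mxZ mxE.
Qed.

Lemma extended_adm_anti x y : x *m extended_adm y = - (y *m extended_adm x).
Proof.
move: x; apply: row_vector_ind => [|i|a x x' IHx IHx'].
- by rewrite mul0mx linear0 mulmx0 oppr0.
- move: y; apply: row_vector_ind => [|j|a y y' IHy IHy'].
  + by rewrite mul0mx linear0 mulmx0 oppr0.
  + rewrite !extended_adm_delta -!(map_delta_mx f) -!map_mxM adm_anti.
    exact: raddfN.
  + rewrite linearP mulmxDr mulmxDl -scalemxAl -scalemxAr IHy IHy'.
    by rewrite opprD scalerN.
by rewrite linearP mulmxDr mulmxDl -scalemxAl -scalemxAr IHx IHx' opprD scalerN.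
Qed.

Lemma extended_adm_bracket x y :
  extended_adm (y *m extended_adm x) =
  extended_adm y *m extended_adm x - extended_adm x *m extended_adm y.
Proof.
move: x; apply: row_vector_ind => [|i|a x x' IHx IHx'].
- by rewrite !linear0 mul0mx subrr.
- move: y; apply: row_vector_ind => [|j|a y y' IHy IHy'].
  + by rewrite !(mul0mx, linear0, addr0).
  + rewrite !extended_adm_delta -!(map_delta_mx f) -!map_mxM extended_adm_map.
    by rewrite adm_bracket raddfB.
  + rewrite mulmxDl -scalemxAl !extended_adm_linear IHy IHy' mulmxDl mulmxDr.
    by rewrite -scalemxAl -scalemxAr scalerBr opprD addrACA.
rewrite extended_adm_linear mulmxDr -scalemxAr extended_adm_linear IHx IHx'.
by rewrite mulmxDl mulmxDr -scalemxAl -scalemxAr scalerBr opprD addrACA.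
Qed.

Definition extended_lie : row_lie K n :=
  RowLie extended_adm_anti extended_adm_bracket.

Lemma bracket_form_extended (e : 'cV[F]_n) :
  bracket_form extended_lie e^f = (bracket_form L e)^f.
Proof.
apply/row_matrixP => i; rewrite -map_row !rowE !mul_bracket_form /=.
by rewrite extended_adm_delta -map_mxM map_trmx.
Qed.
End ScalarExtension.

Section RealReeb.
Variables (R : rcfType) (n : nat) (L : row_lie R n).
Variables (e : 'cV[R]_n) (xi : 'rV[R]_n).
Hypotheses (xi_e : xi *m e = 1%:M) (adm_xi_e : L xi *m e = 0).
Hypothesis nondeg : forall x, x *m e = 0 -> L x *m e = 0 -> x = 0.
Hypothesis tr0 : forall x, x *m L xi = 0 -> x *m e = 0 -> \tr (L x) = 0.

(** Nondegeneracy of d eta and triviality of the centralizer in ker eta are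
    rank conditions on matrices, hence survive the extension of scalars from
    R to R[i], where [reeb_spectrum_dim] applies. *)
Theorem contact_dim3 k : \tr (L xi ^+ k.+1) != 0 -> n = 3%N.
Proof.
case: n L e xi xi_e adm_xi_e nondeg tr0 => [|m] L' e' x' xe Dx ndg tr tr_neq0.
  by rewrite /mxtrace big_ord0 eqxx in tr_neq0.
have cent x := centralizer_reeb xe Dx ndg tr tr_neq0 (x := x).
pose f := real_complex R; pose LC := extended_lie f L'.
pose eC := map_mx f e'; pose xC := map_mx f x'.
have LCx : LC xC = map_mx f (L' x') by exact: extended_adm_map.
have xeC : xC *m eC = 1%:M by rewrite -map_mxM xe map_mx1.
have DxC : LC xC *m eC = 0 by rewrite LCx -map_mxM Dx map_mx0.
have ndgC (z : 'rV[R[i]]_m.+1) : z *m eC = 0 -> LC z *m eC = 0 -> z = 0.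
  move=> ze Lz; have : row_free (row_mx eC (bracket_form LC eC)).
    rewrite bracket_form_extended -map_row_mx row_free_map.
    apply: inj_row_free => y /eqP.
    rewrite mul_mx_row row_mx_eq0 mul_bracket_form.
    by rewrite trmx_eq0 => /andP[/eqP ye /eqP Ly]; apply: ndg.
  move/row_free_inj; apply; rewrite mul0mx mul_mx_row mul_bracket_form ze Lz.
  by rewrite trmx0 row_mx0.
have centC (z : 'rV[R[i]]_m.+1) : z *m LC xC = 0 -> z *m eC = 0 -> z = 0.
  move=> zD ze; have : row_free (row_mx (LC xC) eC).
    rewrite LCx -map_row_mx row_free_map; apply: inj_row_free => y /eqP.
    by rewrite mul_mx_row row_mx_eq0 => /andP[/eqP yD /eqP ye]; apply: cent.
  by move/row_free_inj; apply; rewrite mul0mx mul_mx_row zD ze row_mx0.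
have [ds [size_ds char_ds tr_ds]] := exists_spectrum (LC xC).
have [/allP ds0|/allPn[d dds d0]] := boolP (all (pred1 0) ds).
  case/eqP: tr_neq0; apply: (fmorph_inj f); rewrite rmorph0 -trace_map_mx.
  rewrite rmorphXn /= -LCx.
  have := tr_ds ('X^(k.+1)); rewrite rmorphXn /= horner_mx_X => ->.
  by rewrite big_seq big1 // => d /ds0/eqP->; rewrite hornerXn expr0n.
have dim3 := reeb_spectrum_dim xeC DxC ndgC centC size_ds char_ds tr_ds dds d0.
exact: dim3.
Qed.
End RealReeb.

(** * Alternating forms and nondegeneracy *)

Definition update V k (v : 'I_k -> V) (j : 'I_k) (z : V) : 'I_k -> V :=
  fun i => if i == j then z else v i.

Definition multilinear_form (F : fieldType) (V : lmodType F) k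
    (a : form F V k) :=
  forall v j c x y,
    a (update v j (c *: x + y)) = c * a (update v j x) + a (update v j y).

Definition alternating_form (F : fieldType) (V : Type) k (a : form F V k) :=
  forall v i j, i != j -> v i = v j -> a v = 0.

Definition vanishes_on (F : fieldType) (V : Type) k (a : form F V k) x :=
  forall v j, v j = x -> a v = 0.

Lemma update_id V k (v : 'I_k -> V) j : update v j (v j) = v.
Proof. by apply: funext => i; rewrite /update; case: eqVneq => [->|]. Qed.

Lemma wedge_multilinear (F : fieldType) (V : lmodType F) k l
    (a : form F V k) (b : form F V l) :
  multilinear_form a -> multilinear_form b -> multilinear_form (wedge a b).
Proof.
move=> la lb v j c x y; rewrite /wedge mulrCA -mulrDr; congr (_ * _).
rewrite mulr_sumr -big_split /=; apply: eq_bigr => s _.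
have updE m (h : 'I_m -> 'I_(k + l)) i0 : injective h -> h i0 = j ->
    forall z, (fun i => update v j z (h i)) = update (v \o h) i0 z.
  move=> inj_h hi0 z; apply: funext => i.
  by rewrite /update -hi0 (inj_eq inj_h).
have updN m (h : 'I_m -> 'I_(k + l)) : (forall i, h i != j) ->
    forall z, (fun i => update v j z (h i)) = v \o h.
  by move=> hN z; apply: funext => i; rewrite /update (negPf (hN i)).
have inj_l : injective (s \o @lshift k l).
  by apply: inj_comp; [exact: perm_inj | exact: lshift_inj].
have inj_r : injective (s \o @rshift k l).
  by apply: inj_comp; [exact: perm_inj | exact: rshift_inj].
have [i0 sj|i0 sj] := split_ordP ((s^-1)%g j).
  have ji0 : s (lshift l i0) = j by rewrite -sj permKV.
  have rN i : s (rshift k i) != j.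
    by rewrite -ji0 (inj_eq perm_inj) eq_shift.
  rewrite !(updE _ _ _ inj_l ji0) !(updN _ (s \o @rshift k l) rN) la.
  by rewrite mulrDr mulrDl mulrCA -(mulrA c).
have ji0 : s (rshift k i0) = j by rewrite -sj permKV.
have lN i : s (lshift l i) != j.
  by rewrite -ji0 (inj_eq perm_inj) eq_shift.
rewrite !(updE _ _ _ inj_r ji0) !(updN _ (s \o @lshift k l) lN) lb.
by rewrite mulrDr mulrCA.
Qed.

(** The wedge product sums over all permutations, and composing with the
    transposition of two equal arguments exchanges terms of opposite signs. *)
Lemma wedge_alternating (F : numFieldType) (V : Type) k l
    (a : form F V k) (b : form F V l) : alternating_form (wedge a b).
Proof.
move=> v i j neq_ij vij; rewrite /wedge.
set S := \sum_s _; suff S0 : S = - S.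
  suff -> : S = 0 by rewrite mulr0.
  by apply/eqP; move/eqP: S0; rewrite -addr_eq0 -mulr2n mulrn_eq0.
rewrite {1}/S (reindex_inj (mulIg (tperm i j))) -sumrN; apply: eq_bigr => s _.
have vt (m : 'I_(k + l)) : v ((s * tperm i j)%g m) = v (s m).
  by rewrite permM; case: tpermP => [->|->|].
have vtl : (fun m => v ((s * tperm i j)%g (lshift l m))) =
    fun m => v (s (lshift l m)).
  exact: funext.
have vtr : (fun m => v ((s * tperm i j)%g (rshift k m))) =
    fun m => v (s (rshift k m)).
  exact: funext.
by rewrite vtl vtr odd_permM odd_tperm neq_ij addbT signrN !mulNr.
Qed.

Lemma wedge_vanishes (F : fieldType) (V : Type) k l
    (a : form F V k) (b : form F V l) x :
  vanishes_on a x -> vanishes_on b x -> vanishes_on (wedge a b) x.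
Proof.
move=> a0 b0 v j vj; rewrite /wedge big1 ?mulr0 // => s _.
have [i0 sj|i0 sj] := split_ordP ((s^-1)%g j).
  by rewrite (a0 _ i0) ?mulr0 ?mul0r // -sj permKV.
by rewrite (b0 _ i0) ?mulr0 // -sj permKV.
Qed.

Lemma update_sum (F : fieldType) (V : lmodType F) k (a : form F V k)
    (v : 'I_k -> V) (c : 'I_k -> F) j :
  multilinear_form a -> alternating_form a ->
  a (update v j (\sum_i c i *: v i)) = c j * a v.
Proof.
move=> la alta.
have a0 : a (update v j 0) = 0.
  have := la v j 1 0 0; rewrite scale1r addr0 mul1r => /eqP.
  by rewrite -subr_eq subrr eq_sym => /eqP.
have E (r : seq 'I_k) : a (update v j (\sum_(i <- r) c i *: v i)) =
    \sum_(i <- r) c i * a (update v j (v i)).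
  by elim: r => [|i r IHr]; rewrite ?big_nil // !big_cons la IHr.
rewrite E (bigD1 j) //= update_id big1 ?addr0 // => i neq_ij.
rewrite (alta _ i j neq_ij) ?mulr0 // /update eqxx.
by rewrite (negPf neq_ij).
Qed.

(** A family v with a v <> 0 is a basis, and replacing v i by x multiplies
    a v by the i-th coordinate of x in this basis. *)
Lemma vanishing_direction (F : fieldType) (V : vectType F) k
    (a : form F V k) x v :
  \dim {:V} = k -> multilinear_form a -> alternating_form a ->
  vanishes_on a x -> a v != 0 -> x = 0.
Proof.
move=> dimV la alta a0 av.
pose X := [tuple v i | i < k].
have Xi (i : 'I_k) : X`_i = v i by rewrite -tnth_nth tnth_mktuple.
have upd0 c : a (update v c 0) = 0.
  have := la v c 1 0 0; rewrite scale1r addr0 mul1r => /eqP.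
  by rewrite -subr_eq subrr eq_sym => /eqP.
have freeX : free X.
  apply/freeP => c sum0 i.
  have := update_sum v c i la alta; rewrite (eq_bigr (fun j => c j *: X`_j)).
    by rewrite sum0 upd0 => /esym/eqP; rewrite mulf_eq0 (negPf av) orbF => /eqP.
  by move=> j _; rewrite Xi.
have basisX : basis_of {:V} X.
  by rewrite basisEfree freeX subvf size_tuple dimV /=.
rewrite (coord_basis basisX (memvf x)) big1 // => i _.
have := update_sum v (fun i => coord X i x) i la alta.
rewrite (eq_bigr (fun j => coord X j x *: X`_j)) => [|j _]; last by rewrite Xi.
rewrite -(coord_basis basisX (memvf x)) (a0 _ i) /update ?eqxx //.
move=> /esym/eqP; rewrite mulf_eq0 (negPf av) orbF => /eqP ->.
by rewrite scale0r.
Qed.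

Section LieBilinear.
Variables (R : pzRingType) (g : lieAlgType R).
Implicit Types (k : R) (u v w : g).

Lemma lieDl u v w : lie (u + v) w = lie u w + lie v w.
Proof. by have := lie_linear_l w 1 u v; rewrite !scale1r. Qed.

Lemma lieDr u v w : lie u (v + w) = lie u v + lie u w.
Proof. by have := lie_linear_r u 1 v w; rewrite !scale1r. Qed.

Lemma lieC u v : lie u v = - lie v u.
Proof.
have := liexx (u + v); rewrite lieDl !lieDr !liexx add0r addr0 => /eqP.
by rewrite addr_eq0 => /eqP.
Qed.

Lemma lie0r u : lie u 0 = 0.
Proof. by apply: (addrI (lie u 0)); rewrite -lieDr !addr0. Qed.

Lemma lieZr k u v : lie u (k *: v) = k *: lie u v.
Proof. by have := lie_linear_r u k v 0; rewrite addr0 lie0r addr0. Qed.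

Lemma lieZl k u v : lie (k *: u) v = k *: lie u v.
Proof. by rewrite lieC lieZr -scalerN -lieC. Qed.

Lemma lieNr u v : lie u (- v) = - lie u v.
Proof. by apply/eqP; rewrite -addr_eq0 -lieDr addNr lie0r. Qed.
End LieBilinear.

Section ContactForm.
Variables (R : realType) (g : finLieAlgType R) (eta : 'Hom(g, R^o)).

Lemma form_of_dual_multilinear : multilinear_form (form_of_dual eta).
Proof. by move=> v j c x y; rewrite /form_of_dual /update (ord1 j) !linearP. Qed.

Lemma dform_multilinear : multilinear_form (dform eta).
Proof.
move=> v j c x y; rewrite /dform /dd /update.
have -> : (ord_max : 'I_2) = lift ord0 ord0 by apply: val_inj.
case: (unliftP ord0 j) => [j'|] ->; rewrite ?(ord1 j') /= ?eqxx.
  by rewrite lie_linear_r linearP /= opprD mulrN.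
by rewrite lie_linear_l linearP /= opprD mulrN.
Qed.

Lemma wedge_exp_multilinear n : multilinear_form (wedge_exp (dform eta) n).
Proof.
elim: n => [|n IHn]; first by move=> v [].
exact: wedge_multilinear dform_multilinear IHn.
Qed.

(** Both eta and d eta vanish as soon as one argument is x, and so does
    eta /\ (d eta)^n. *)
Lemma contact_nondegenerate x :
  contact eta -> eta x = 0 -> (forall y, dd eta x y = 0) -> x = 0.
Proof.
move=> [n [dimg [v nv]]] ex dx.
pose a := wedge (form_of_dual eta) (wedge_exp (dform eta) n).
have dx' y : dd eta y x = 0.
  by rewrite /dd lieC linearN opprK -[RHS]oppr0 -(dx y) opprK.
have ax : vanishes_on a x.
  apply: wedge_vanishes => [u j|]; first by rewrite (ord1 j) /form_of_dual => ->.
  elim: n {dimg v nv a} => [|n IHn]; first by move=> u [].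
  apply: wedge_vanishes IHn => u j; rewrite /dform.
  have -> : (ord_max : 'I_2) = lift ord0 ord0 by apply: val_inj.
  by case: (unliftP ord0 j) => [j'|] ->; rewrite ?(ord1 j') => ->.
apply: (vanishing_direction _ _ _ ax nv); first by rewrite dimg add1n muln2.
  exact: wedge_multilinear form_of_dual_multilinear (@wedge_exp_multilinear n).
exact: wedge_alternating.
Qed.
End ContactForm.

(** * Passage to coordinates *)

Section Coordinates.
Variables (R : realType) (g : finLieAlgType R).
Local Notation n := (\dim {:g}).
Let b : n.-tuple g := vbasis {:g}.
Let bP : basis_of {:g} b := vbasisP {:g}.
Implicit Types x y : 'rV[R]_n.

Definition coord_adm x : 'M[R]_n := mxof b b (ad (vecof b x)).

Lemma coord_adm_linear : linear coord_adm.
Proof.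
move=> a x y; rewrite /coord_adm.
have -> : ad (vecof b (a *: x + y)) =
    a *: ad (vecof b x) + ad (vecof b y).
  apply/lfunP => z.
  by rewrite add_lfunE scale_lfunE !adE vecof_linear lie_linear_l.
by rewrite mxof_linear.
Qed.
HB.instance Definition _ :=
  GRing.isLinear.Build R 'rV[R]_n 'M[R]_n *:%R coord_adm coord_adm_linear.

Lemma mul_coord_adm x y :
  y *m coord_adm x = rVof b (lie (vecof b x) (vecof b y)).
Proof. by rewrite mul_mxof adE. Qed.

Lemma coord_adm_anti x y : x *m coord_adm y = - (y *m coord_adm x).
Proof. by rewrite !mul_coord_adm lieC linearN. Qed.

Lemma coord_adm_bracket x y :
  coord_adm (y *m coord_adm x) =
  coord_adm y *m coord_adm x - coord_adm x *m coord_adm y.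
Proof.
rewrite -!(mxof_comp b b bP) mul_coord_adm /coord_adm.
rewrite rVofK // -linearB; congr (mxof b b _); apply/lfunP => z.
rewrite add_lfunE opp_lfunE !comp_lfunE !adE.
move: (vecof b x) (vecof b y) => u v.
have := lie_jacobi u v z; rewrite (lieC z (lie u v)) (lieC z u).
have -> : lie v (- lie u z) = - lie v (lie u z).
  by rewrite -!(adE v) linearN.
by move/eqP; rewrite subr_eq0 => /eqP.
Qed.

Definition coord_lie : row_lie R n := RowLie coord_adm_anti coord_adm_bracket.

Definition coord_form (eta : 'Hom(g, R^o)) : 'cV[R]_n :=
  \col_i eta (vecof b (delta_mx 0 i)).

Lemma mul_coord_form x eta : x *m coord_form eta = (eta (vecof b x))%:M.
Proof.
rewrite /vecof linear_sum; apply/matrixP => i j; rewrite !ord1 !mxE eqxx mulr1n.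
by apply: eq_bigr => k _; rewrite mxE vecof_delta linearZ.
Qed.

Lemma pr_kerE (eta : 'Hom(g, R^o)) (xi : g) : eta xi = 1 ->
  forall z, linfun (@vsval _ _ (lker eta)) (pr_ker eta xi z) = z - eta z *: xi.
Proof.
move=> exi z.
have vsvalE w : linfun (@vsval _ _ (lker eta)) w = vsval w by rewrite lfunE.
have vsprojE w : linfun (vsproj (lker eta)) w = vsproj (lker eta) w.
  by rewrite lfunE.
rewrite vsvalE [pr_ker _ _ _]comp_lfunE vsprojE vsprojK; last exact: memv_pi.
have cap0 : (lker eta :&: <[xi]> = 0)%VS.
  apply/eqP; rewrite -subv0; apply/subvP => v; rewrite memv_cap memv_ker memv0.
  case/andP => /eqP ev /vlineP[c vE]; move: ev; rewrite vE linearZ /= exi.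
  by rewrite [c *: _]mulr1 => ->; rewrite scale0r.
have zin : z \in (lker eta + <[xi]>)%VS.
  rewrite -(subrK (eta z *: xi) z) memv_add ?memvZ ?memv_line //.
  by rewrite memv_ker linearB linearZ /= exi [_ *: 1]mulr1 subrr.
have := daddv_pi_add cap0 zin.
have /vlineP[c ->] := memv_pi <[xi]>%VS (lker eta) z.
have := memv_pi (lker eta) <[xi]>%VS z; rewrite memv_ker => /eqP e1 zE.
have -> : eta z = c.
  by rewrite -zE linearD linearZ /= e1 exi add0r [c *: _]mulr1.
by rewrite -[in RHS]zE addrK.
Qed.

(** Projection onto ker eta followed by inclusion is y |-> y - eta(y) xi, a
    rank-one perturbation of the identity; by cyclicity of the trace the
    perturbation contributes eta [z, xi]. *)
Lemma lfun_trace_transverse (eta : 'Hom(g, R^o)) (xi z : g) :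
  eta xi = 1 -> eta (lie z xi) = 0 ->
  lfun_trace (transverse_ad eta xi z) = lfun_trace (ad z).
Proof.
move=> exi ezxi; rewrite /lfun_trace /transverse_ad.
pose c := vbasis {: subvs_of (lker eta)}.
have cP : basis_of {: subvs_of (lker eta)} c by apply: vbasisP.
rewrite (mxof_comp c c bP) (mxof_comp b c bP) mulmxA mxtrace_mulC.
rewrite mulmxA -(mxof_comp b b cP).
have -> : (linfun (@vsval _ _ (lker eta)) \o pr_ker eta xi)%VF =
    hommx b b (1%:M - coord_form eta *m rVof b xi).
  apply/lfunP => y; rewrite comp_lfunE pr_kerE // hommxE // mulmxBr mulmx1.
  rewrite mulmxA mul_coord_form mul_scalar_mx. 
  rewrite -[in RHS]scaleNr [in RHS]addrC vecof_linear !(rVofK bP).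
  by rewrite scaleNr addrC.
rewrite hommxK // mulmxBl mul1mx linearB /= -mulmxA mxtrace_mulC.
rewrite mul_mxof rVofK // adE mul_coord_form rVofK // ezxi.
by rewrite raddf0 linear0 subr0.
Qed.

Theorem reeb_not_nilpotent (eta : 'Hom(g, R^o)) (xi : g) :
  contact eta -> reeb eta xi -> unimodular g \/ transversely_unimodular eta xi ->
  ~ lfun_nilpotent (ad xi) ->
  \dim {:g} = 3%N /\ (forall z, lie xi z = 0 -> eta z = 0 -> z = 0).
Proof.
move=> cont [exi dxi] unim notnil.
have exi' z : eta (lie xi z) = 0.
  by apply/eqP; rewrite -oppr_eq0; apply/eqP/dxi.
pose e := coord_form eta; pose x := rVof b xi.
have ker_e (y : 'rV_n) : y *m e = 0 -> eta (vecof b y) = 0.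
  by rewrite mul_coord_form => /matrixP/(_ 0 0); rewrite !mxE eqxx mulr1n.
have xe : x *m e = 1%:M by rewrite mul_coord_form rVofK // exi.
have Dx : coord_lie x *m e = 0.
  apply: mulmx_rV_eq0 => y; rewrite mulmxA mul_coord_form /= mul_coord_adm.
  by rewrite !rVofK // exi' raddf0.
have ndg (y : 'rV_n) : y *m e = 0 -> coord_lie y *m e = 0 -> y = 0.
  move=> /ker_e ey ley; apply/eqP; rewrite -(vecof_eq0 bP); apply/eqP.
  apply: (contact_nondegenerate cont) => // z.
  have : rVof b z *m coord_lie y *m e = 0 by rewrite -mulmxA ley mulmx0.
  rewrite /= mul_coord_adm => /ker_e; rewrite !rVofK // /dd => ->.
  by rewrite oppr0.
have tr0 (y : 'rV_n) :
    y *m coord_lie x = 0 -> y *m e = 0 -> \tr (coord_lie y) = 0.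
  rewrite /= mul_coord_adm => /eqP; rewrite (rVof_eq0 bP) rVofK // => /eqP yD.
  move=> /ker_e ey; rewrite -/(lfun_trace (ad (vecof b y))).
  case: unim => [->//|tu]; rewrite -(lfun_trace_transverse (xi := xi) exi).
    by apply: tu; rewrite memv_cap !memv_ker adE yD ey !eqxx.
  by rewrite lieC yD oppr0 linear0.
have [k trk] : exists k, \tr (coord_lie x ^+ k.+1) != 0.
  apply: contrapT => /forallNP tr_eq0; apply: notnil.
  have [|k Dk] := @nilpotent_of_mxtrace _ _ (coord_lie x).
    by move=> k; apply/eqP/negPn/negP; exact: tr_eq0.
  exists k => z; apply/eqP; rewrite -(rVof_eq0 bP).
  suff -> : rVof b (iter k (ad xi) z) = rVof b z *m coord_lie x ^+ k.
    by rewrite Dk mulmx0.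
  elim: k {Dk} => [|k IHk]; first by rewrite mulmx1.
  rewrite iterS (rVof_app b bP) IHk exprSr -mulmxE mulmxA /=.
  by rewrite /coord_adm rVofK.
split; first exact: contact_dim3 xe Dx ndg tr0 _ trk.
move=> z zD ez; apply/eqP; rewrite -(rVof_eq0 bP); apply/eqP.
apply: (centralizer_reeb xe Dx ndg tr0 trk).
  by rewrite /= mul_coord_adm !rVofK // zD linear0.
by rewrite mul_coord_form rVofK // ez raddf0.
Qed.
End Coordinates.

(** * Three-dimensional Lie algebras *)

(** For nonzero kap and bet these relations define the real forms of
    sl(2, C). *)
Definition standard_triple (R : pzRingType) (g : lieAlgType R) (e1 e2 e3 : g)
    (kap bet : R) :=
  [/\ lie e1 e2 = e3, lie e1 e3 = kap *: e2 & lie e2 e3 = bet *: e1].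

Definition triple_comb (R : pzRingType) (V : lmodType R) (e1 e2 e3 : V)
    (a b c : R) := a *: e1 + b *: e2 + c *: e3.

Lemma lie_triple_comb (R : comPzRingType) (g : lieAlgType R) (e1 e2 e3 : g)
    (kap bet a b c a' b' c' : R) :
  standard_triple e1 e2 e3 kap bet ->
  lie (triple_comb e1 e2 e3 a b c) (triple_comb e1 e2 e3 a' b' c') =
  triple_comb e1 e2 e3 (bet * (b * c' - c * b')) (kap * (a * c' - c * a'))
    (a * b' - b * a').
Proof.
case=> e12 e13 e23; rewrite /triple_comb.
rewrite !lieDl !lieDr !lieZl !lieZr !liexx !scaler0.
rewrite (lieC e2 e1) (lieC e3 e1) (lieC e3 e2) e12 e13 e23.
rewrite !(addr0, add0r) !scalerN !scalerA.
rewrite !mulrBr !scalerBl ![_ * _ * kap]mulrC ![_ * _ * bet]mulrC !addrA.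
by rewrite [LHS](ACl (4*6*2*5*1*3)).
Qed.

Definition frame_map (R : pzRingType) (V : lmodType R) (e1 e2 e3 : V)
    (t : R * R * R) := triple_comb e1 e2 e3 t.1.1 t.1.2 t.2.

(** Bases are expressed as bijective parametrizations, a notion which makes
    sense for modules that carry no chosen coordinates, like sl(2) and su(2)
    as matrix subtypes. *)
Definition frame (R : pzRingType) (V : lmodType R) (e1 e2 e3 : V) :=
  bijective (frame_map e1 e2 e3).

Lemma frame_of_free (R : fieldType) (V : vectType R) (e1 e2 e3 : V) :
  \dim {:V} = 3%N ->
  (forall a b c, triple_comb e1 e2 e3 a b c = 0 -> [/\ a = 0, b = 0 & c = 0]) ->
  frame e1 e2 e3.
Proof.
move=> dimV indep; pose X := [tuple e1; e2; e3].
have sumX (k : 'I_3 -> R) : \sum_i k i *: X`_i =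
    triple_comb e1 e2 e3 (k ord0) (k (lift ord0 ord0)) (k ord_max).
  rewrite !big_ord_recl big_ord0 /= addr0 addrA /triple_comb.
  by congr (_ + _ + k _ *: _); apply: val_inj.
have freeX : free X.
  apply/freeP => k; rewrite sumX => /indep[k0 k1 k2] i.
  have [i' ->|->] := unliftP ord_max i; last by [].
  have [i'' ->|->] := unliftP ord0 i'; last first.
    by rewrite -k0; congr k; apply: val_inj.
  by rewrite -k1 (ord1 i''); congr k; apply: val_inj.
have basisX : basis_of {:V} X by rewrite basisEfree freeX subvf dimV.
pose co z := (coord X ord0 z, coord X (lift ord0 ord0) z, coord X ord_max z).
have coK z : frame_map e1 e2 e3 (co z) = z.
  by rewrite [RHS](coord_basis basisX (memvf z)) sumX.
have subP (t u : R * R * R) :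
    frame_map e1 e2 e3 t = frame_map e1 e2 e3 u -> t = u.
  case: t u => [[a b] c] [[a' b'] c'] /eqP; rewrite -subr_eq0 => /eqP E.
  have [|] := indep (a - a') (b - b') (c - c').
    rewrite -[RHS]E /frame_map /triple_comb /= !scalerBl !opprD !addrA.
    by rewrite [LHS](ACl (1*3*5*2*4*6)).
  by move=> /subr0_eq-> /subr0_eq-> /subr0_eq->.
by exists co => // t; apply: subP; rewrite coK.
Qed.

Lemma standard_triple_isomorphic (R : comPzRingType) (g h : lieAlgType R)
    (e1 e2 e3 : g) (f1 f2 f3 : h) kap bet :
  frame e1 e2 e3 -> frame f1 f2 f3 ->
  standard_triple e1 e2 e3 kap bet -> standard_triple f1 f2 f3 kap bet ->
  lie_isomorphic g h.
Proof.
move=> [co eK coK] frf ste stf.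
pose f (z : g) : h := frame_map f1 f2 f3 (co z).
have combP (V : lmodType R) (v1 v2 v3 : V) k t u :
    frame_map v1 v2 v3 (k * t.1.1 + u.1.1, k * t.1.2 + u.1.2, k * t.2 + u.2) =
    k *: frame_map v1 v2 v3 t + frame_map v1 v2 v3 u.
  rewrite /frame_map /triple_comb /= !scalerDl !scalerDr -!scalerA !addrA.
  by rewrite [LHS](ACl (1*3*5*2*4*6)).
have f_lin : linear f.
  move=> k x y; rewrite /f -combP; congr frame_map.
  by rewrite -[RHS]eK combP !coK.
have f_lie x y : f (lie x y) = lie (f x) (f y).
  rewrite -{1}(coK x) -{1}(coK y) /f.
  rewrite [lie (frame_map e1 e2 e3 _) _](lie_triple_comb _ _ _ _ _ _ ste).
  rewrite [RHS](lie_triple_comb _ _ _ _ _ _ stf).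
  set t := (X in _ = triple_comb _ _ _ X _ _).
  set u := (X in _ = triple_comb _ _ _ _ X _).
  set w := (X in _ = triple_comb _ _ _ _ _ X).
  by rewrite -[triple_comb e1 e2 e3 t u w]/(frame_map e1 e2 e3 (t, u, w)) eK.
have f_bij : bijective f by apply: bij_comp frf _; exists (frame_map e1 e2 e3).
pose m := GRing.isLinear.Build R g h *:%R f f_lin.
pose F : {linear g -> h} := HB.pack f m.
by exists F.
Qed.

Lemma matrix2P (T : Type) (A B : 'M[T]_2) :
  A ord0 ord0 = B ord0 ord0 -> A ord0 ord_max = B ord0 ord_max ->
  A ord_max ord0 = B ord_max ord0 -> A ord_max ord_max = B ord_max ord_max ->
  A = B.
Proof.
have ord2 (i : 'I_2) : i = ord0 \/ i = ord_max.
  by case: i => [[|[|//]] ?]; [left | right]; apply: val_inj.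
move=> e00 e01 e10 e11; apply/matrixP => i j.
by have [->|->] := ord2 i; have [->|->] := ord2 j.
Qed.

Definition mx2 (T : Type) (a b c d : T) : 'M[T]_2 :=
  \matrix_(i, j) if i == ord0 then (if j == ord0 then a else b)
                 else (if j == ord0 then c else d).

Lemma mx2_mul (S : pzRingType) (a b c d a' b' c' d' : S) :
  mx2 a b c d *m mx2 a' b' c' d' =
  mx2 (a * a' + b * c') (a * b' + b * d') (c * a' + d * c') (c * b' + d * d').
Proof. by apply: matrix2P; rewrite !mxE !big_ord_recl big_ord0 !mxE /= addr0. Qed.

Section SL2Frame.
Variable R : realType.

Fact sl2_mx_subproof (a b c : R) : sl2_pred (mx2 a b c (- a)).
Proof.
by rewrite /sl2_pred /mxtrace !big_ord_recl big_ord0 !mxE /= addr0 subrr.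
Qed.
Definition sl2_mx (a b c : R) : sl2 R := Sub _ (sl2_mx_subproof a b c).

Lemma sl2_mx_frame (s bet : R) : s != 0 -> bet != 0 ->
  frame (sl2_mx s 0 0) (sl2_mx 0 1 (- bet / 4)) (sl2_mx 0 (2 * s) (s * bet / 2)).
Proof.
move=> s0 bet0.
pose co (A : sl2 R) : R * R * R :=
  let x := val A ord0 ord_max in let y := val A ord_max ord0 in
  (val A ord0 ord0 / s, x / 2 - 2 * y / bet, (x / 2 + 2 * y / bet) / (2 * s)).
exists co => [[[a b] c]|A].
  rewrite /co /frame_map /triple_comb /= !mxE /=.
  by congr (_, _, _); field; rewrite ?s0 ?bet0.
apply: val_inj; rewrite /= /frame_map /triple_comb /=.
have := valP A; rewrite /sl2_pred /mxtrace !big_ord_recl big_ord0 /= addr0.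
have -> : lift ord0 ord0 = ord_max :> 'I_2 by apply: val_inj.
rewrite addr_eq0 => /eqP A00.
apply: matrix2P; rewrite !mxE /=.
- by field; rewrite s0.
- by field; rewrite s0 bet0.
- by field; rewrite s0 bet0.
- by rewrite A00; field; rewrite s0.
Qed.

Lemma sl2_mx_triple (s bet : R) :
  standard_triple (sl2_mx s 0 0) (sl2_mx 0 1 (- bet / 4))
    (sl2_mx 0 (2 * s) (s * bet / 2)) (4 * s ^+ 2) bet.
Proof.
split; apply: val_inj; rewrite /= /commmx !mx2_mul; apply: matrix2P;
  rewrite !mxE /=; by field.
Qed.
End SL2Frame.

Section SU2Frame.
Variable R : realType.
Local Notation C := R[i].
Local Open Scope complex_scope.

Definition su2_entries (a b c : R) : 'M[C]_2 :=
  mx2 (0 +i* a) (b +i* c) (- b +i* c) (0 +i* - a).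

Fact su2_mx_subproof (a b c : R) : su2_pred (su2_entries a b c).
Proof.
rewrite /su2_pred /mxtrace !big_ord_recl big_ord0 !mxE /=; apply/andP; split.
  apply/eqP/matrix2P; rewrite !mxE /=; simpc; by rewrite ?oppr0 ?opprK.
by simpc.
Qed.
Definition su2_mx (a b c : R) : su2 R := Sub _ (su2_mx_subproof a b c).

Lemma su2_mx_frame (p q r : R) : p != 0 -> q != 0 -> r != 0 ->
  frame (su2_mx p 0 0) (su2_mx 0 q 0) (su2_mx 0 0 r).
Proof.
move=> p0 q0 r0.
have val_frame t :
    val (frame_map (su2_mx p 0 0) (su2_mx 0 q 0) (su2_mx 0 0 r) t) =
    su2_entries (t.1.1 * p) (t.1.2 * q) (t.2 * r).
  by apply: matrix2P; rewrite !mxE /=; simpc.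
pose co (A : su2 R) : R * R * R :=
  let M : 'M[C]_2 := val A in
  (complex.Im (M ord0 ord0) / p, complex.Re (M ord0 ord_max) / q,
   complex.Im (M ord0 ord_max) / r).
exists co => [[[a b] c]|A].
  by rewrite /co val_frame !mxE /= (mulfK p0) (mulfK q0) (mulfK r0).
pose M : 'M[C]_2 := val A.
have /andP[/eqP adjA /eqP trA] := valP A.
have adjE i j : conjc (M j i) = - M i j.
  by have /matrixP/(_ i j) := adjA; rewrite !mxE.
have M00 : M ord0 ord0 = 0 +i* complex.Im (M ord0 ord0).
  have := adjE ord0 ord0; case: (M ord0 ord0) => x y /=; simpc => -[/eqP].
  by rewrite -addr_eq0 -mulr2n mulrn_eq0 /= => /eqP->.
have M11 : M ord_max ord_max = - M ord0 ord0.
  apply/eqP; rewrite -addr_eq0 addrC -trA /mxtrace !big_ord_recl big_ord0 addr0.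
  by apply/eqP; congr (_ + M _ _); apply: val_inj.
have M10 : M ord_max ord0 = - conjc (M ord0 ord_max).
  by rewrite (adjE ord_max ord0) opprK.
apply: val_inj; rewrite val_frame /= !divfK //; apply: (@matrix2P C _ M).
- by rewrite [LHS]mxE M00.
- by rewrite [LHS]mxE; case: (M ord0 ord_max).
- rewrite [LHS]mxE M10; case: (M ord0 ord_max) => x y /=; by simpc.
- by rewrite [LHS]mxE M11 M00; simpc.
Qed.

Lemma su2_mx_triple (p q : R) :
  standard_triple (su2_mx (p / 2) 0 0) (su2_mx 0 (q / 2) 0)
    (su2_mx 0 0 (p * q / 2)) (- p ^+ 2) (q ^+ 2).
Proof.
split; apply: val_inj; rewrite /= /commmx !mx2_mul; apply: matrix2P;
  by rewrite !mxE /=; simpc; congr (_ +i* _); field.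
Qed.
End SU2Frame.

(** The square of ad e1 is multiplication by kap on the span of e2 and e3.
    If kap > 0, ad e1 is diagonalizable and g is sl(2).  If kap < 0 < bet, all
    the structure constants have the same sign and g is su(2).  If both are
    negative, e2 takes the part of e1, for the square of ad e2 is - bet. *)
Lemma standard_triple_sl2_su2 (R : realType) (g : finLieAlgType R)
    (e1 e2 e3 : g) (kap bet : R) :
  \dim {:g} = 3%N -> frame e1 e2 e3 -> standard_triple e1 e2 e3 kap bet ->
  kap != 0 -> bet != 0 -> lie_isomorphic g (sl2 R) \/ lie_isomorphic g (su2 R).
Proof.
move=> dimg.
have pos (f1 f2 f3 : g) k b : 0 < k -> b != 0 -> frame f1 f2 f3 ->
    standard_triple f1 f2 f3 k b -> lie_isomorphic g (sl2 R).
  move=> k0 b0 fr st; pose s := Num.sqrt k / 2.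
  have s0 : s != 0 by rewrite mulf_neq0 ?invr_eq0 ?pnatr_eq0 // gt_eqF ?sqrtr_gt0.
  have ks : 4 * s ^+ 2 = k.
    by rewrite /s expr_div_n sqr_sqrtr ?ltW //; field.
  apply: (standard_triple_isomorphic fr (sl2_mx_frame s0 b0) st).
  by rewrite -[in X in standard_triple _ _ _ X]ks; apply: sl2_mx_triple.
move=> fr st kap0 bet0; have [kap_gt0|kap_le0] := ltP 0 kap.
  by left; apply: pos kap_gt0 bet0 fr st.
have [bet_gt0|bet_le0] := ltP 0 bet.
  right; pose p := Num.sqrt (- kap); pose q := Num.sqrt bet.
  have kap_lt0 : kap < 0 by rewrite lt_neqAle kap0.
  have p0 : p != 0 by rewrite gt_eqF // sqrtr_gt0 oppr_gt0.
  have q0 : q != 0 by rewrite gt_eqF // sqrtr_gt0.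
  have kp : - p ^+ 2 = kap by rewrite sqr_sqrtr ?opprK // oppr_ge0.
  have bq : q ^+ 2 = bet by rewrite sqr_sqrtr // ltW.
  have h0 (z : R) : z != 0 -> z / 2 != 0.
    by move=> z0; rewrite mulf_neq0 // invr_eq0 pnatr_eq0.
  have frm := su2_mx_frame (h0 _ p0) (h0 _ q0) (h0 _ (mulf_neq0 p0 q0)).
  apply: (standard_triple_isomorphic fr frm st).
  by have := su2_mx_triple p q; rewrite kp bq.
left; have nbet_gt0 : 0 < - bet by rewrite oppr_gt0 lt_neqAle bet0.
have [e12 e13 e23] := st.
have indep a b c : triple_comb e1 e2 e3 a b c = 0 -> [/\ a = 0, b = 0 & c = 0].
  move=> E; have /(bij_inj fr)[] // :
      frame_map e1 e2 e3 (a, b, c) = frame_map e1 e2 e3 (0, 0, 0).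
  by rewrite /frame_map /= E /triple_comb !scale0r !addr0.
have b2 : - (bet * kap) != 0 by rewrite oppr_eq0 mulf_neq0.
apply: (pos e2 e3 (bet *: e1) _ _ nbet_gt0 b2).
  apply: frame_of_free => // a b c E.
  have [] := indep (c * bet) a b.
    by rewrite -[RHS]E /triple_comb scalerA [RHS]addrC addrA.
  by move=> /eqP; rewrite mulf_eq0 (negPf bet0) orbF => /eqP -> -> ->.
split; first by [].
  by rewrite -[lie e2 _](adE e2) linearZ /= adE lieC e12 scalerN scaleNr.
by rewrite -[lie e3 _](adE e3) linearZ /= adE lieC e13 scalerN scalerA scaleNr.
Qed.

(** The bilinear form (x, y) |-> eta [x, D y] on ker eta is symmetric, because
    D is infinitesimally symplectic, and nonzero, because D is injective on
    ker eta.  Any x with eta [x, D x] <> 0 completes to the frame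
    xi, x, D x. *)
Lemma contact_dim3_isomorphic (R : realType) (g : finLieAlgType R)
    (eta : 'Hom(g, R^o)) (xi : g) :
  contact eta -> reeb eta xi -> \dim {:g} = 3%N ->
  (forall z, lie xi z = 0 -> eta z = 0 -> z = 0) ->
  lie_isomorphic g (sl2 R) \/ lie_isomorphic g (su2 R).
Proof.
move=> cont [exi dxi] dimg cent.
have exi' z : eta (lie xi z) = 0.
  by apply/eqP; rewrite -oppr_eq0; apply/eqP/dxi.
have der (x y : g) : lie xi (lie x y) = lie (lie xi x) y + lie x (lie xi y).
  have := lie_jacobi xi x y.
  rewrite (lieC y (lie xi x)) (lieC y xi) lieNr => /eqP.
  by rewrite -addrA -opprD subr_eq0 addrC => /eqP.
have [x ex qx] : exists2 x, eta x = 0 & eta (lie x (lie xi x)) != 0.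
  apply: contrapT => noq.
  have q0 x : eta x = 0 -> eta (lie x (lie xi x)) = 0.
    by move=> ex; apply/eqP; apply: contra_notT noq => qx; exists x.
  have h0 x : eta x = 0 -> x = 0.
    move=> ex; apply: cent => //; apply: (contact_nondegenerate cont) => // z.
    have sym y : eta (lie x (lie xi y)) = eta (lie y (lie xi x)).
      have := exi' (lie x y); rewrite der linearD (lieC (lie xi x)) linearN.
      by move/eqP; rewrite addrC subr_eq0 => /eqP.
    have ey0 y : eta y = 0 -> eta (lie y (lie xi x)) = 0.
      move=> ey; have exy : eta (x + y) = 0 by rewrite linearD /= ex ey addr0.
      have := q0 _ exy; rewrite !(lieDl, lieDr) !linearD /=.
      rewrite (q0 _ ex) (q0 _ ey) sym addr0 add0r.
      by move/eqP; rewrite -mulr2n mulrn_eq0 => /eqP.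
    rewrite /dd lieC linearN opprK -[z](subrK (eta z *: xi)) lieDl linearD /=.
    rewrite ey0.
      rewrite add0r lieC lieZr linearN linearZ /= lieC linearN /= exi'.
      by rewrite oppr0 scaler0 oppr0.
    by rewrite linearB linearZ /= exi [_ *: 1]mulr1 subrr.
  have : ({:g} <= <[xi]>)%VS.
    apply/subvP => z _; rewrite -(subrK (eta z *: xi) z) (h0 (z - _)).
      by rewrite add0r memvZ ?memv_line.
    by rewrite linearB linearZ /= exi [_ *: 1]mulr1 subrr.
  by move/dimvS; rewrite dimg dim_vline; case: (xi != 0).
pose y := lie xi x; pose bet := eta (lie x y).
have ey : eta y = 0 by exact: exi'.
have indep a b c : triple_comb xi x y a b c = 0 -> [/\ a = 0, b = 0 & c = 0].
  rewrite /triple_comb => E.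
  have a0 : a = 0.
    have := congr1 eta E; rewrite !linearD !linearZ /= exi ex ey.
    by rewrite (raddf0 eta) [_ *: 1]mulr1 !scaler0 !addr0.
  have c0 : c = 0.
    have := congr1 (fun z => eta (lie x z)) E.
    rewrite a0 scale0r add0r lieDr !lieZr liexx scaler0 add0r linearZ /= -/bet.
    rewrite lie0r linear0 => /eqP; rewrite mulf_eq0 (negPf qx) orbF.
    by move/eqP.
  split=> //; move: E; rewrite a0 c0 !scale0r add0r addr0 => /eqP.
  rewrite scaler_eq0 => /orP[/eqP//|/eqP x0]; case/eqP: qx.
  by rewrite x0 !lie0r linear0.
have fr := frame_of_free dimg indep.
have [co _ coK] := fr; case E : (co (lie xi y)) => [[a kap] mu].
have Dy : lie xi y = triple_comb xi x y a kap mu by rewrite -[LHS]coK E.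
have a0 : a = 0.
  have := exi' y; rewrite Dy !linearD !linearZ /= exi ex ey.
  by rewrite [_ *: 1]mulr1 !scaler0 !addr0.
have Dxy : lie xi (lie x y) = mu *: lie x y.
  rewrite der liexx add0r Dy /triple_comb a0 scale0r add0r lieDr !lieZr.
  by rewrite liexx scaler0 add0r.
have mu0 : mu = 0.
  have := exi' (lie x y); rewrite Dxy linearZ => /eqP.
  by rewrite mulf_eq0 (negPf qx) orbF => /eqP.
have xyE : lie x y = bet *: xi.
  apply/eqP; rewrite -subr_eq0; apply/eqP/cent.
    by rewrite lieDr lieNr lieZr liexx scaler0 subr0 Dxy mu0 scale0r.
  by rewrite linearB linearZ /= exi [_ *: 1]mulr1 subrr.
have DyE : lie xi y = kap *: x.
  by rewrite Dy /triple_comb a0 mu0 !scale0r add0r addr0.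
have kap0 : kap != 0.
  apply: contraNneq qx => k0; have y0 : y = 0.
    by apply: cent ey; rewrite DyE k0 scale0r.
  by rewrite -/y y0 lie0r linear0.
exact: (@standard_triple_sl2_su2 _ _ xi x y kap bet).
Qed.

Theorem theorem1p1 (R : realType) (g : finLieAlgType R)
    (eta : 'Hom(g, R^o)) (xi : g) :
  contact eta ->
  reeb eta xi ->
  unimodular g \/ transversely_unimodular eta xi ->
  ~ lie_isomorphic g (sl2 R) ->
  ~ lie_isomorphic g (su2 R) ->
  lfun_nilpotent (ad xi).
Proof.
move=> cont reeb_xi unim not_sl2 not_su2; apply: contrapT => notnil.
have [dimg cent] := reeb_not_nilpotent cont reeb_xi unim notnil.
by case: (contact_dim3_isomorphic cont reeb_xi dimg cent).
Qed.
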